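(* Let $(r_j)_{j\ge1}$ and $(n_j)_{j\ge1}$ be sequences of integers with $1 \le r_j < n_j-1$ for all $j$, such that $\lim_{j\to\infty} n_j = \infty$ and $\lim_{j\to\infty} \frac{r_j}{n_j} = \alpha$ with $0<\alpha<1$. Then: (1) The zeros of $B_{r_j,n_j}(z)$ converge uniformly to points of the curve $C_\alpha$, i.e. $$\sup_{z\,:\,B_{r_j,n_j}(z)=0} d(z,C_\alpha) \to 0 \quad\text{as } j\to\infty,$$ where $d(z,C_\alpha)=\inf_{\zeta\in C_\alpha}|z-\zeta|$. (2) Each point of $C_\alpha$ is a limit point of zeros of the sequence $\{B_{r_j,n_j}(z)\}_{j=1}^\infty$.
   Context: For integers $1\le r\le n$, $B_{r,n}(z)=\sum_{k=0}^r\binom{n}{k}z^k$, $z\in\mathbb{C}$. For $0<\alpha<1$, $K_\alpha=\alpha^\alpha(1-\alpha)^{1-\alpha}$ and $$C_\alpha = \left\{ z\in\mathbb{C} : \frac{|z|^\alpha}{|1+z|} = K_\alpha,\ |z| \le \frac{\alpha}{1-\alpha} \right\}.$$ A point $\zeta\in\mathbb{C}$ is a limit point of zeros of a sequence of polynomials $\{p_j\}$ if there are indices $j_1<j_2<\cdots$ and zeros $z_{i}$ of $p_{j_i}$ with $z_i\to\zeta$. *)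

(* Defs.v *)
From HB Require Import structures.
From mathcomp Require Import all_boot all_order all_algebra.
From mathcomp Require Import all_classical all_reals all_analysis.
From mathcomp Require Import complex.
Set Implicit Arguments.
Unset Strict Implicit.
Unset Printing Implicit Defensive.
Import Order.TTheory GRing.Theory Num.Theory numFieldNormedType.Exports.
Local Open Scope classical_set_scope.
Local Open Scope ring_scope.
Local Open Scope complex_scope.

(* The modulus as an element of R; the library's norm on R[i] takes values in
   R[i]. *)
Definition cmod {R : realType} (z : R[i]) : R := ComplexField.Normc.normc z.

Definition Bpoly (R : realType) (r n : nat) : {poly R[i]} :=
  \sum_(0 <= k < r.+1) 'C(n, k)%:R *: 'X^k.

Definition zeros {R : realType} (p : {poly R[i]}) : set R[i] :=
  [set z | root p z].

Definition Kconst {R : realType} (alpha : R) : R :=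
  alpha `^ alpha * (1 - alpha) `^ (1 - alpha).

(* At z = -1 the quotient is 0 by the convention x / 0 = 0; as Kconst alpha > 0
   for 0 < alpha < 1, the point -1, where the quotient is not defined, is
   excluded. *)
Definition Ccurve {R : realType} (alpha : R) : set R[i] :=
  [set z | cmod z `^ alpha / cmod (1 + z) = Kconst alpha
           /\ cmod z <= alpha / (1 - alpha)].

(* Extended-real infimum and supremum: unlike inf and sup on R, they give no
   default value on empty or unbounded sets. *)
Definition dist_to {R : realType} (A : set R[i]) (z : R[i]) : \bar R :=
  ereal_inf [set (cmod (z - zeta))%:E | zeta in A].

Definition sup_dist {R : realType} (Z A : set R[i]) : \bar R :=
  ereal_sup [set dist_to A z | z in Z].

(* R[i]^o carries the topology given by the modulus; R[i] itself has no
   canonical topology in the library. *)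
Definition limit_point_of_zeros {R : realType} (p : nat -> {poly R[i]})
    (zeta : R[i]) : Prop :=
  exists (phi : nat -> nat) (z : nat -> R[i]^o),
    [/\ forall i j, (i < j)%N -> (phi i < phi j)%N,
        forall i, zeros (p (phi i)) (z i) &
        z i @[i --> \oo] --> (zeta : R[i]^o)].

(* Main.v *)
Require Import Defs.
From HB Require Import structures.
From mathcomp Require Import all_boot all_order all_algebra.
From mathcomp Require Import all_classical all_reals all_analysis.
From mathcomp Require Import complex.
From mathcomp Require Import ring lra zify.
Set Implicit Arguments.
Unset Strict Implicit.
Unset Printing Implicit Defensive.
Import Order.TTheory GRing.Theory Num.Theory numFieldNormedType.Exports.
Local Open Scope classical_set_scope.
Local Open Scope ring_scope.

(* Write B for [Bpoly R r n], T = (1 + z)^n - B for the tail of the binomial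
   expansion, m(z) = C(n, r) |z|^r for its leading size, and a = alpha / (1 - alpha).

   Zeros of B satisfy (1 + z)^n = T. By the Enestroem-Kakeya theorem they lie in
   |z| <= r / (n - r + 1), where the terms of T decrease in modulus; summation by
   parts then shows that |T| equals m(z) up to a factor polynomial in n, because a
   zero cannot be too close to the positive axis. As C(n, r)^(1/n) tends to
   1 / Kconst alpha, taking n-th roots gives |z|^alpha / |1 + z| -> Kconst alpha
   uniformly over the zeros, and compactness gives (1).

   For (2), the identity (1 + z) B' = n B - (n - r) C(n, r) z^r shows that
   Q = (n - r) C(n, r) z^r / (n B) is 1 - (1 + z) B' / (n B), which is Lipschitz
   uniformly in n on discs that stay away from the zeros. For |z| < a, Q tends to 0
   where |z|^alpha / |1 + z| < Kconst alpha (there (1 + z)^n dominates) and is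
   bounded below where the opposite inequality holds (there m(z) dominates). Both
   kinds of points exist arbitrarily close to any point of the curve other than a,
   so zeros must accumulate there; the point a is a limit of other curve points. *)

(** * Moduli of complex numbers and summation by parts *)

Lemma cmodE (R : realType) (z : R[i]) :
  cmod z = Num.sqrt (complex.Re z ^+ 2 + complex.Im z ^+ 2).
Proof. by case: z. Qed.

Lemma sqr_cmod (R : realType) (z : R[i]) :
  cmod z ^+ 2 = complex.Re z ^+ 2 + complex.Im z ^+ 2.
Proof. by rewrite cmodE sqr_sqrtr // addr_ge0 ?sqr_ge0. Qed.

Lemma cmod_ge0 (R : realType) (z : R[i]) : 0 <= cmod z.
Proof. by rewrite cmodE sqrtr_ge0. Qed.

Lemma norm_cmod (R : realType) (z : R[i]) : `|z| = (cmod z)%:C%C.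
Proof. by rewrite normc_def cmodE. Qed.

Lemma cmodM (R : realType) (x y : R[i]) : cmod (x * y) = cmod x * cmod y.
Proof. exact: ComplexField.Normc.normcM. Qed.

Lemma cmodV (R : realType) (x : R[i]) : cmod x^-1 = (cmod x)^-1.
Proof. exact: ComplexField.Normc.normcV. Qed.

Lemma cmodN (R : realType) (x : R[i]) : cmod (- x) = cmod x.
Proof. by apply: complexI; rewrite -!norm_cmod normrN. Qed.

Lemma cmodB (R : realType) (x y : R[i]) : cmod (x - y) = cmod (y - x).
Proof. by rewrite -cmodN opprB. Qed.

Lemma cmodX (R : realType) (x : R[i]) k : cmod (x ^+ k) = cmod x ^+ k.
Proof. by apply: complexI; rewrite rmorphXn -!norm_cmod normrX. Qed.

Lemma cmodD (R : realType) (x y : R[i]) : cmod (x + y) <= cmod x + cmod y.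
Proof. by rewrite -lecR rmorphD -!norm_cmod ler_normD. Qed.

Lemma cmodBD (R : realType) (x y : R[i]) : cmod (x - y) <= cmod x + cmod y.
Proof. by rewrite -(cmodN y) cmodD. Qed.

Lemma cmodB_ge (R : realType) (x y : R[i]) : cmod x - cmod y <= cmod (x - y).
Proof. by rewrite lerBlDr -{1}(subrK y x) cmodD. Qed.

Lemma cmodD_ge (R : realType) (x y : R[i]) : cmod x - cmod y <= cmod (x + y).
Proof. by rewrite -(cmodN y) -{2}(opprK y) cmodB_ge. Qed.

Lemma cmod_real (R : realType) (x : R) : cmod x%:C%C = `|x|.
Proof. by rewrite cmodE /= expr0n /= addr0 sqrtr_sqr. Qed.

Lemma cmod_nat (R : realType) k : cmod (k%:R : R[i]) = k%:R.
Proof. by rewrite -(rmorph_nat (real_complex R)) cmod_real ger0_norm. Qed.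

Lemma cmod1 (R : realType) : cmod (1 : R[i]) = 1.
Proof. exact: (cmod_nat R 1). Qed.

Lemma cmod0 (R : realType) : cmod (0 : R[i]) = 0.
Proof. exact: (cmod_nat R 0). Qed.

Lemma cmod_eq0 (R : realType) (x : R[i]) : (cmod x == 0) = (x == 0).
Proof.
apply/eqP/eqP => [|->]; last exact: cmod0.
exact: ComplexField.Normc.eq0_normc.
Qed.

Lemma cmod_gt0 (R : realType) (x : R[i]) : (0 < cmod x) = (x != 0).
Proof. by rewrite lt_def cmod_ge0 andbT cmod_eq0. Qed.

Lemma cmod_sum (R : realType) (I : Type) (s : seq I) (P : pred I) (F : I -> R[i]) :
  cmod (\sum_(i <- s | P i) F i) <= \sum_(i <- s | P i) cmod (F i).
Proof.
rewrite -lecR rmorph_sum -norm_cmod /=.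
by apply: le_trans (ler_norm_sum _ _ _) _; rewrite (eq_bigr _ (fun i _ => norm_cmod (F i))).
Qed.

Lemma Re_le_cmod (R : realType) (z : R[i]) : `|complex.Re z| <= cmod z.
Proof.
rewrite -(@ler_pXn2r _ 2%N) ?nnegrE ?cmod_ge0 // sqr_cmod real_normK ?num_real //.
by rewrite lerDl sqr_ge0.
Qed.

Lemma Im_le_cmod (R : realType) (z : R[i]) : `|complex.Im z| <= cmod z.
Proof.
rewrite -(@ler_pXn2r _ 2%N) ?nnegrE ?cmod_ge0 // sqr_cmod real_normK ?num_real //.
by rewrite lerDr sqr_ge0.
Qed.

Lemma cReD (R : realType) (x y : R[i]) :
  complex.Re (x + y) = complex.Re x + complex.Re y.
Proof. by case: x; case: y. Qed.

Lemma cReB (R : realType) (x y : R[i]) :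
  complex.Re (x - y) = complex.Re x - complex.Re y.
Proof. by case: x; case: y. Qed.

Lemma cImD (R : realType) (x y : R[i]) :
  complex.Im (x + y) = complex.Im x + complex.Im y.
Proof. by case: x; case: y. Qed.

Lemma cImB (R : realType) (x y : R[i]) :
  complex.Im (x - y) = complex.Im x - complex.Im y.
Proof. by case: x; case: y. Qed.

Lemma cReMr (R : realType) (x : R) (y : R[i]) :
  complex.Re (x%:C%C * y) = x * complex.Re y.
Proof. by case: y => a b /=; rewrite mul0r subr0. Qed.

Lemma cRe_sum (R : realType) (I : Type) (s : seq I) (P : pred I) (F : I -> R[i]) :
  complex.Re (\sum_(i <- s | P i) F i) = \sum_(i <- s | P i) complex.Re (F i).
Proof. by apply: (big_morph _ (@cReD R)). Qed.

(** Multiplying by 1 - w replaces the coefficients by their consecutive differences, so that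
    monotone coefficients can be estimated by telescoping. *)
Lemma abel_sum (K : comNzRingType) (e : nat -> K) (w : K) m :
  (1 - w) * (\sum_(k < m.+1) e k * w ^+ k) =
  e 0%N - (\sum_(k < m) (e k - e k.+1) * w ^+ k.+1) - e m * w ^+ m.+1.
Proof.
elim: m => [|m IH]; first by rewrite big_ord_recl !big_ord0 /= expr0 expr1; ring.
rewrite big_ord_recr /= mulrDr IH [in RHS]big_ord_recr /= !exprS; ring.
Qed.

(** If |u| > 1, summation by parts at a zero gives e_m |u|^(m+1) <= e_0 + sum (e_(k+1) - e_k)
    |u|^(k+1). The right side telescopes to at most e_m |u|^m, which is smaller. *)
Lemma enestrom_kakeya (R : realType) (e : nat -> R) (m : nat) (u : R[i]) :
  (forall k, (k < m)%N -> e k <= e k.+1) -> 0 <= e 0%N -> 0 < e m ->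
  \sum_(k < m.+1) (e k)%:C%C * u ^+ k = 0 -> cmod u <= 1.
Proof.
move=> e_incr e0 em S0; rewrite leNgt; apply/negP => u1.
have := abel_sum (fun k => (e k)%:C%C) u m; rewrite S0 mulr0.
move/eqP; rewrite eq_sym subr_eq0 => /eqP /(congr1 cmod).
rewrite cmodM cmodX cmod_real gtr0_norm // => H.
have : e m * cmod u ^+ m.+1 <= e m * cmod u ^+ m.
  rewrite -H; apply: le_trans (cmodBD _ _) _; rewrite cmod_real ger0_norm //.
  have -> : e m * cmod u ^+ m = e 0%N * cmod u ^+ m
       + \sum_(k < m) (e k.+1 - e k) * cmod u ^+ m.
    rewrite -mulr_suml -mulrDl; congr (_ * _).
    by rewrite -(big_mkord predT (fun k => e k.+1 - e k)) telescope_sumr // addrC subrK.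
  apply: lerD; first by rewrite ler_peMr // exprn_ege1 // ltW.
  apply: le_trans (cmod_sum _ _ _) _; apply: ler_sum => k _.
  rewrite cmodM cmodX -rmorphB cmod_real ler0_norm ?subr_le0 ?e_incr // opprB.
  by rewrite ler_wpM2l ?subr_ge0 ?e_incr // ler_weXn2l // ltW.
rewrite ler_pM2l // exprS ger_pMl ?exprn_gt0 ?(lt_trans _ u1) //.
by rewrite leNgt u1.
Qed.

(** In the real part of (1 - w) S the first difference is kept exactly and every other power of w is
    bounded by 1; telescoping leaves (e_0 - e_1) (1 - Re w). On the unit circle |1 - w|^2 = 2 (1 -
    Re w), and one factor |1 - w| cancels. *)
Lemma decreasing_sum_ge (R : realType) (e : nat -> R) (m : nat) (w : R[i]) :
  (forall k, (k <= m)%N -> e k.+1 <= e k) -> 0 <= e m.+1 -> cmod w = 1 ->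
  (e 0%N - e 1%N) / 2 * cmod (1 - w) <= cmod (\sum_(k < m.+2) (e k)%:C%C * w ^+ k).
Proof.
move=> e_decr em w1; set S := \sum_(_ < _) _.
have Rew k : complex.Re (w ^+ k) <= 1.
  by apply: le_trans (ler_norm _) _; rewrite (le_trans (Re_le_cmod _)) // cmodX w1 expr1n.
have sq1w : cmod (1 - w) ^+ 2 = 2 * (1 - complex.Re w).
  have := sqr_cmod w; rewrite w1 sqr_cmod; rewrite cReB cImB /=; nra.
have key : (e 0%N - e 1%N) * (1 - complex.Re w) <= cmod ((1 - w) * S).
  apply: le_trans (le_trans (ler_norm _) (Re_le_cmod _)).
  rewrite /S (abel_sum (fun k => (e k)%:C%C)) !cReB cReMr cRe_sum big_ord_recl /= expr1 -rmorphB cReMr.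
  have le1 : e m.+1 * complex.Re (w ^+ m.+2) <= e m.+1 by rewrite ler_piMr.
  have le2 : \sum_(i < m) complex.Re (((e (bump 0 i))%:C%C - (e (bump 0 i).+1)%:C%C) * w ^+ (bump 0 i).+1)
        <= e 1%N - e m.+1.
    apply: (@le_trans _ _ (\sum_(i < m) (e i.+1 - e i.+2))).
      apply: ler_sum => i _; rewrite -rmorphB cReMr ler_piMr //.
      by rewrite subr_ge0 e_decr.
    rewrite -opprB -(telescope_sumr (fun i => e i.+1)) // big_mkord -sumrN.
    by rewrite le_eqVlt; apply/orP; left; apply/eqP; apply: eq_bigr => i _; rewrite opprB.
  by move: le1 le2; set X := \sum_(_ < _) _; set Y := _ * complex.Re (_ ^+ _); lra.
have [->|w_neq1] := eqVneq (1 - w) 0; first by rewrite cmod0 mulr0 cmod_ge0.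
rewrite -(@ler_pM2l _ (cmod (1 - w))) ?cmod_gt0 // -cmodM; apply: le_trans key.
by rewrite mulrCA -expr2 sq1w; lra.
Qed.

(** * The truncated binomial polynomial: tail, derivative, factorization *)

Lemma Bpoly_horner (R : realType) (r n : nat) (z : R[i]) :
  (Bpoly R r n).[z] = \sum_(k < r.+1) 'C(n, k)%:R * z ^+ k.
Proof.
rewrite /Bpoly big_mkord horner_sum; apply: eq_bigr => k _.
by rewrite hornerZ hornerXn.
Qed.

Definition bin_tail (R : realType) (r n : nat) (z : R[i]) : R[i] :=
  \sum_(i < n - r) 'C(n, r.+1 + i)%:R * z ^+ (r.+1 + i).

Lemma Bpoly_tail (R : realType) (r n : nat) (z : R[i]) : (r <= n)%N ->
  (1 + z) ^+ n = (Bpoly R r n).[z] + bin_tail r n z.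
Proof.
move=> rn; rewrite exprDn Bpoly_horner /bin_tail.
rewrite -(big_mkord xpredT (fun i => 1 ^+ (n - i) * z ^+ i *+ 'C(n, i))).
rewrite (@big_cat_nat _ _ _ r.+1) //= big_mkord; congr (_ + _).
  by apply: eq_bigr => k _; rewrite expr1n mul1r mulr_natl.
rewrite -{1}[r.+1]add0n big_addn subSS big_mkord.
by apply: eq_bigr => k _; rewrite expr1n mul1r addnC mulr_natl.
Qed.

(** Induction on r: the new term is absorbed by (n - r) C(n, r) = (r + 1) C(n, r + 1). *)
Lemma Bpoly_deriv (R : realType) (r n : nat) (z : R[i]) : (r <= n)%N ->
  (1 + z) * (Bpoly R r n)^`().[z] =
  n%:R * (Bpoly R r n).[z] - (n - r)%:R * 'C(n, r)%:R * z ^+ r.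
Proof.
elim: r => [|r IH] rn.
  rewrite /Bpoly big_nat1 bin0 expr0 scale1r derivC hornerC hornerC subn0; ring.
have := IH (ltnW rn); rewrite /Bpoly => {}IH.
rewrite big_nat_recr //= derivD !hornerD mulrDr IH derivZ derivXn !hornerZ hornerMn !hornerXn /=.
have E : (n - r)%:R * 'C(n, r)%:R = r.+1%:R * 'C(n, r.+1)%:R :> R[i].
  by rewrite -!natrM mul_bin_left.
rewrite E natrB // -mulr_natl exprS; ring.
Qed.

(** The logarithmic derivative of a split polynomial, through which [quot] becomes a sum over the
    zeros. *)
Lemma horner_prod_deriv (F : fieldType) (c : F) (s : seq F) (x : F) : x \notin s ->
  (c *: \prod_(z <- s) ('X - z%:P))^`().[x] =
  (c *: \prod_(z <- s) ('X - z%:P)).[x] * \sum_(z <- s) (x - z)^-1.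
Proof.
move=> xs; rewrite derivZ !hornerZ -mulrA; congr (_ * _).
elim: s xs => [|a s IH]; first by rewrite !big_nil derivC hornerC mulr0.
rewrite inE negb_or => /andP[xa xs]; rewrite !big_cons derivM hornerD !hornerM IH //.
rewrite derivXsubC hornerXsubC hornerC mul1r; set P := _.[x]; set S := \sum_(_ <- _) _.
by rewrite mulrDr mulrAC divff ?subr_eq0 // mul1r mulrA.
Qed.

Lemma size_Bpoly (R : realType) (r n : nat) : (r <= n)%N -> size (Bpoly R r n) = r.+1.
Proof.
move=> rn; have -> : Bpoly R r n = \poly_(k < r.+1) 'C(n, k)%:R.
  by rewrite poly_def /Bpoly big_mkord.
by rewrite size_poly_eq //= pnatr_eq0 -lt0n bin_gt0.
Qed.

Lemma Bpoly_split (R : realType) (r n : nat) : (r <= n)%N ->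
  exists2 s : seq R[i], size s = r &
    Bpoly R r n = lead_coef (Bpoly R r n) *: \prod_(z <- s) ('X - z%:P).
Proof.
move=> rn; have [s Es] := closed_field_poly_normal (Bpoly R r n).
exists s => //; have := size_Bpoly R rn; rewrite {1}Es size_scale ?size_prod_XsubC; first by case.
by rewrite lead_coef_eq0 -size_poly_eq0 size_Bpoly.
Qed.

Lemma Bpoly_root (R : realType) (r n : nat) : (1 <= r <= n)%N ->
  exists z, root (Bpoly R r n) z.
Proof.
case/andP => r1 rn; apply/closed_rootP.
by rewrite size_Bpoly // eqSS -lt0n.
Qed.

(** * Bounds for the zeros of a fixed polynomial *)

Lemma bin_succ_real (R : realType) (n k : nat) :
  k.+1%:R * 'C(n, k.+1)%:R = (n - k)%:R * 'C(n, k)%:R :> R.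
Proof. by rewrite -!natrM mul_bin_left. Qed.

Lemma Bpoly_zero_neq0 (R : realType) (r n : nat) (z : R[i]) :
  root (Bpoly R r n) z -> z != 0.
Proof.
apply: contraTneq => ->; rewrite rootE Bpoly_horner big_ord_recl /= bin0 expr0 mulr1.
rewrite big1 ?addr0 ?oner_eq0 // => i _.
by rewrite exprS mul0r mulr0.
Qed.

(** After the rescaling z = R0 u with R0 = r / (n - r + 1), consecutive coefficients have ratio (n -
    k) / (k + 1) R0. For k < r this is smallest at k = r - 1, where it is 1, so [enestrom_kakeya]
    applies. *)
Lemma Bpoly_zero_le (R : realType) (r n : nat) (z : R[i]) : (1 <= r <= n)%N ->
  root (Bpoly R r n) z -> cmod z <= r%:R / (n - r).+1%:R.
Proof.
move=> /andP[r1 rn] /eqP Bz; set R0 : R := _ / _.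
have R0_gt0 : 0 < R0 by rewrite divr_gt0 ?ltr0n.
have R0c : R0%:C%C != 0 :> R[i] by rewrite eq_complex /= eqxx andbT gt_eqF.
suff : cmod (z / R0%:C%C) <= 1.
  by rewrite cmodM cmodV cmod_real gtr0_norm // ler_pdivrMr // mul1r.
apply: (@enestrom_kakeya _ (fun k => 'C(n, k)%:R * R0 ^+ k) r).
- move=> k kr /=; rewrite exprSr mulrA mulrAC ler_wpM2r ?exprn_ge0 ?(ltW R0_gt0) //.
  rewrite -(@ler_pM2l _ k.+1%:R) ?ltr0n // mulrA bin_succ_real.
  rewrite mulrAC ler_wpM2r ?ler0n //.
  rewrite mulrA ler_pdivlMr ?ltr0n // -!natrM ler_nat; nia.
- by rewrite bin0 expr0 mulr1.
- by rewrite mulr_gt0 ?exprn_gt0 // ltr0n bin_gt0.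
rewrite -[RHS]Bz Bpoly_horner; apply: eq_bigr => k _.
by rewrite rmorphM rmorphXn rmorph_nat -mulrA -exprMn mulrCA divff // mulr1.
Qed.

Lemma cmod_1BX (R : realType) (w : R[i]) k : cmod w <= 1 ->
  cmod (1 - w ^+ k) <= k%:R * cmod (1 - w).
Proof.
move=> w1; elim: k => [|k IH]; first by rewrite expr0 subrr cmod0 mul0r.
have -> : 1 - w ^+ k.+1 = (1 - w) + w * (1 - w ^+ k) by rewrite exprS; ring.
rewrite -natr1 mulrDl mul1r [leRHS]addrC; apply: le_trans (cmodD _ _) _; rewrite lerD //.
by rewrite cmodM (le_trans _ IH) // ler_piMl // cmod_ge0.
Qed.

Lemma cmod_unit (R : realType) (z : R[i]) : z != 0 -> cmod (z / (cmod z)%:C%C) = 1.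
Proof.
move=> z0; rewrite cmodM cmodV cmod_real ger0_norm ?cmod_ge0 // divff //.
by rewrite cmod_eq0.
Qed.

Lemma polarE (R : realType) (z : R[i]) : z = (cmod z)%:C%C * (z / (cmod z)%:C%C).
Proof.
have [->|z0] := eqVneq z 0; first by rewrite mul0r mulr0.
by rewrite mulrCA divff ?mulr1 // eq_complex /= eqxx andbT cmod_eq0.
Qed.

(* If the argument of [z] were too small, all [z ^+ k] with [k <= n] would have
   positive real part. *)
Lemma Bpoly_zero_arg (R : realType) (r n : nat) (z : R[i]) : (r <= n)%N ->
  root (Bpoly R r n) z -> 1 <= n%:R * cmod (1 - z / (cmod z)%:C%C).
Proof.
move=> rn Bz; have z0 := Bpoly_zero_neq0 Bz; rewrite leNgt; apply/negP => small.
move: Bz; rewrite rootE Bpoly_horner big_ord_recl bin0 expr0 mulr1 => /eqP.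
move/(congr1 (@complex.Re R)); rewrite cReD cRe_sum /=; set w := z / _ in small *.
have H : 0 <= \sum_(i < r) complex.Re ('C(n, bump 0 i)%:R * z ^+ (bump 0 i)).
  apply: sumr_ge0 => i _.
  have -> k : 'C(n, k)%:R * z ^+ k = ('C(n, k)%:R * cmod z ^+ k)%:C%C * w ^+ k.
    by rewrite {1}(polarE z) -/w exprMn rmorphM rmorphXn rmorph_nat mulrA.
  rewrite cReMr.
  apply: mulr_ge0; first by rewrite mulr_ge0 ?ler0n ?exprn_ge0 ?cmod_ge0.
  have : cmod (1 - w ^+ bump 0 i) < 1.
    apply: le_lt_trans small; apply: le_trans (cmod_1BX _ _) _; first by rewrite cmod_unit.
    by rewrite ler_wpM2r ?cmod_ge0 // ler_nat (leq_trans _ rn) //= /bump; case: i.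
  move/(le_lt_trans (Re_le_cmod _)); rewrite cReB ltr_norml => /andP[_] /=; lra.
by move=> E; move: H; rewrite -(lerD2l 1) E; lra.
Qed.

(** The ratio (n - k) / (k + 1) x of consecutive terms decreases in k, so from k = r on it is at
    most its value at r. *)
Lemma bin_term_le (R : realType) (r n i : nat) (x : R) : 0 <= x ->
  'C(n, r + i)%:R * x ^+ (r + i) <=
  'C(n, r)%:R * x ^+ r * ((n - r)%:R / r.+1%:R * x) ^+ i.
Proof.
move=> x0; elim: i => [|i IH]; first by rewrite addn0 expr0 mulr1.
rewrite addnS [in leRHS]exprSr [leRHS]mulrA.
have q0 : 0 <= (n - r)%:R / r.+1%:R * x by rewrite mulr_ge0 // divr_ge0.
apply: le_trans (ler_wpM2r q0 IH).
set A := (n - r)%:R / _.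
have -> : 'C(n, r + i)%:R * x ^+ (r + i) * (A * x) = x ^+ (r + i).+1 * ('C(n, r + i)%:R * A).
  by rewrite exprS; ring.
rewrite [leLHS]mulrC ler_wpM2l ?exprn_ge0 //.
rewrite -(@ler_pM2l _ (r + i).+1%:R) ?ltr0n // bin_succ_real.
rewrite mulrCA [leLHS]mulrC ler_wpM2l // mulrA ler_pdivlMr ?ltr0n // -!natrM ler_nat.
rewrite mulnC; apply: leq_mul; lia.
Qed.

Lemma cmod_bin_tail (R : realType) (r n : nat) (z : R[i]) :
  cmod (bin_tail r n z) <= 'C(n, r)%:R * cmod z ^+ r *
    \sum_(i < n - r) ((n - r)%:R / r.+1%:R * cmod z) ^+ i.+1.
Proof.
apply: le_trans (cmod_sum _ _ _) _; rewrite mulr_sumr; apply: ler_sum => i _.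
by rewrite cmodM cmod_nat cmodX addSnnS bin_term_le // cmod_ge0.
Qed.

Lemma cmod_bin_tail_le (R : realType) (r n : nat) (z : R[i]) :
  (n - r)%:R / r.+1%:R * cmod z <= 1 ->
  cmod (bin_tail r n z) <= n%:R * ('C(n, r)%:R * cmod z ^+ r).
Proof.
move=> q1; apply: le_trans (cmod_bin_tail _ _ _) _; rewrite mulrC.
rewrite ler_wpM2r ?mulr_ge0 ?exprn_ge0 ?cmod_ge0 //.
apply: (@le_trans _ _ (\sum_(i < n - r) 1)); last first.
  by rewrite sumr_const card_ord ler_nat leq_subr.
apply: ler_sum => i _; rewrite exprn_ile1 // mulr_ge0 ?cmod_ge0 // divr_ge0 //.
Qed.

(** A geometric series instead of a count of the terms: in part (2) the factor in front of the main
    term must not grow with n. *)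
Lemma cmod_bin_tail_lt (R : realType) (r n : nat) (z : R[i]) (q : R) :
  (n - r)%:R / r.+1%:R * cmod z <= q -> q < 1 ->
  cmod (bin_tail r n z) <= 'C(n, r)%:R * cmod z ^+ r / (1 - q).
Proof.
move=> zq q1; apply: le_trans (cmod_bin_tail _ _ _) _.
rewrite ler_wpM2l ?mulr_ge0 ?exprn_ge0 ?cmod_ge0 //.
have q'0 : 0 <= (n - r)%:R / r.+1%:R * cmod z.
  by rewrite mulr_ge0 ?cmod_ge0 // divr_ge0.
have q0 := le_trans q'0 zq.
apply: (@le_trans _ _ (\sum_(i < n - r) q ^+ i)).
  apply: ler_sum => i _; apply: (@le_trans _ _ (q ^+ i.+1)).
    by rewrite lerXn2r ?nnegrE.
  by rewrite ler_wiXn2l // ltW.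
rewrite -[leRHS]mul1r ler_pdivlMr ?subr_gt0 // mulrC -opprB mulNr -subrX1 opprB.
by rewrite lerBlDr lerDl exprn_ge0.
Qed.

(** With w = z / |z|, the tail is w^(r+1) times a sum of powers of w whose coefficients e_i are the
    moduli of its terms, so [decreasing_sum_ge] applies. Three estimates cost a factor n each: e_0 -
    e_1 >= e_0 / n, |1 - w| >= 1 / n and C(n, r + 1) >= C(n, r) / n. *)
Lemma cmod_bin_tail_ge (R : realType) (r n : nat) (z : R[i]) : (r.+2 <= n)%N ->
  z != 0 -> cmod z <= r%:R / (n - r).+1%:R -> 1 <= n%:R * cmod (1 - z / (cmod z)%:C%C) ->
  'C(n, r)%:R * cmod z ^+ r * (cmod z / (2 * n%:R ^+ 3)) <= cmod (bin_tail r n z).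
Proof.
move=> rn z0 zle zarg; set x := cmod z in zle zarg *; set w := z / _ in zarg.
have x0 : 0 < x by rewrite cmod_gt0.
have n0 : 0 < n%:R :> R by rewrite ltr0n; lia.
pose e i := 'C(n, r.+1 + i)%:R * x ^+ (r.+1 + i).
(* As r + 2 <= n, the tail has at least two terms, which the difference e_0 - e_1 requires. *)
have [m nrE] : exists m, (n - r)%N = m.+2 by exists (n - r - 2)%N; lia.
have e_ge0 k : 0 <= e k by rewrite mulr_ge0 ?exprn_ge0 // ltW.
(* The ratio of consecutive moduli, bounded by means of |z| <= r / (n - r + 1) and
   cross-multiplied. *)
have e_step k : e k.+1 * ((n - r).+1 * (r + k.+2))%:R <= e k * (r * (n - (r.+1 + k)))%:R.
  rewrite /e addnS exprSr [(r + k.+2)%N]addnS -addSnnS natrM.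
  set N := (r.+1 + k)%N.
  have -> : 'C(n, N.+1)%:R * (x ^+ N * x) * ((n - r).+1%:R * N.+1%:R) =
      (N.+1%:R * 'C(n, N.+1)%:R) * x ^+ N * (x * (n - r).+1%:R) by ring.
  rewrite bin_succ_real natrM.
  have -> : 'C(n, N)%:R * x ^+ N * (r%:R * (n - N)%:R) =
    (n - N)%:R * 'C(n, N)%:R * x ^+ N * r%:R :> R by ring.
  rewrite ler_wpM2l ?mulr_ge0 ?exprn_ge0 ?(ltW x0) //.
  by rewrite -ler_pdivlMr ?ltr0n.
have e_decr k : e k.+1 <= e k.
  have : e k.+1 * ((n - r).+1 * (r + k.+2))%:R <= e k * ((n - r).+1 * (r + k.+2))%:R.
    by apply: le_trans (e_step k) _; rewrite ler_wpM2l // ler_nat; nia.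
  by rewrite ler_pM2r // ltr0n muln_gt0; lia.
have e01 : e 0%N <= n%:R * (e 0%N - e 1%N).
  have := e_step 0%N; rewrite addn0 addn2.
  (* Here e_1 A <= e_0 B with A = (n - r + 1) (r + 2) and B = r (n - r - 1). Since A - B = 2 (n +
     1), A is at most n (A - B), which yields e_0 <= n (e_0 - e_1). *)
  set A : R := (_ * _)%:R; set B : R := (_ * _)%:R => AB.
  have A0 : 0 < A by rewrite ltr0n muln_gt0; lia.
  have AnB : A <= n%:R * (A - B).
    have -> : A - B = (2 * n.+1)%:R.
      apply/eqP; rewrite subr_eq -natrD eqr_nat; apply/eqP.
      have [s ->] : exists s, n = (r + s.+1)%N by exists (n - r.+1)%N; lia.
      have -> : (r + s.+1 - r.+1)%N = s by lia.
      by rewrite addKn; nia.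
    by rewrite -natrM ler_nat mulnA (mulnC _ n.+1); apply: leq_mul; lia.
  rewrite -(ler_pM2r A0).
  have H1 : e 0%N * A <= e 0%N * (n%:R * (A - B)) by rewrite ler_wpM2l.
  have H2 : n%:R * (e 1%N * A) <= n%:R * (e 0%N * B) by rewrite ler_wpM2l.
  apply: (le_trans H1).
  have -> : e 0%N * (n%:R * (A - B)) = n%:R * (e 0%N * A) - n%:R * (e 0%N * B) by ring.
  have -> : n%:R * (e 0%N - e 1%N) * A = n%:R * (e 0%N * A) - n%:R * (e 1%N * A) by ring.
  by rewrite lerD2l lerN2.
have tailE : cmod (bin_tail r n z) = cmod (\sum_(k < m.+2) (e k)%:C%C * w ^+ k).
  have -> : bin_tail r n z = w ^+ r.+1 * \sum_(k < m.+2) (e k)%:C%C * w ^+ k.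
    rewrite /bin_tail nrE mulr_sumr; apply: eq_bigr => k _.
    rewrite {1}(polarE z) -/w -/x exprMn -rmorphXn /e [in RHS]rmorphM rmorph_nat [w ^+ (_ + _)]exprD.
    by rewrite [LHS]mulrA [LHS]mulrCA.
  by rewrite cmodM cmodX cmod_unit // expr1n mul1r.
rewrite tailE.
apply: le_trans (@decreasing_sum_ge _ e m w _ _ _) => //; last by rewrite cmod_unit.
have e0E : 'C(n, r)%:R * x ^+ r * x <= n%:R * e 0%N.
  rewrite /e addn0 exprSr.
  have : 'C(n, r)%:R <= n%:R * 'C(n, r.+1)%:R :> R.
    apply: (@le_trans _ _ ((n - r)%:R * 'C(n, r)%:R)).
      by rewrite ler_peMl // ler1n; lia.
    by rewrite -bin_succ_real ler_wpM2r // ler_nat; lia.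
  move=> H; have : 'C(n, r)%:R * (x ^+ r * x) <= n%:R * 'C(n, r.+1)%:R * (x ^+ r * x).
    by rewrite ler_wpM2r // mulr_ge0 ?exprn_ge0 // ltW.
  by rewrite !mulrA.
rewrite mulrA ler_pdivrMr ?mulr_gt0 ?exprn_gt0 //.
apply: le_trans e0E _; set c := cmod _ in zarg *.
have c0 : 0 <= c by exact: cmod_ge0.
have -> : (e 0%N - e 1%N) / 2 * c * (2 * n%:R ^+ 3) =
    n%:R * ((n%:R * (e 0%N - e 1%N)) * (n%:R * c)) by field.
rewrite ler_pM2l //; apply: le_trans e01 _.
by rewrite ler_peMr // mulr_ge0 ?subr_ge0 // ltW.
Qed.

Lemma Bpoly_zero_bounds (R : realType) (r n : nat) (z : R[i]) : (1 <= r)%N ->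
  (r.+2 <= n)%N -> root (Bpoly R r n) z ->
  'C(n, r)%:R * cmod z ^+ r * (cmod z / (2 * n%:R ^+ 3)) <= cmod (1 + z) ^+ n
    <= n%:R * ('C(n, r)%:R * cmod z ^+ r).
Proof.
move=> r1 rn Bz; have rn' : (r <= n)%N by lia.
have zle : cmod z <= r%:R / (n - r).+1%:R by apply: Bpoly_zero_le => //; lia.
rewrite -(cmodX (1 + z)) (Bpoly_tail _ rn') (eqP Bz) add0r.
rewrite cmod_bin_tail_ge ?(Bpoly_zero_neq0 Bz) ?(Bpoly_zero_arg _ Bz) //=.
apply: cmod_bin_tail_le.
(* The bound on |z| makes the ratio of the tail terms at most 1. *)
apply: (@le_trans _ _ ((n - r)%:R / r.+1%:R * (r%:R / (n - r).+1%:R))).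
  by rewrite ler_wpM2l // divr_ge0.
rewrite mulrACA -invfM ler_pdivrMr ?mulr_gt0 ?ltr0n // mul1r -!natrM ler_nat; nia.
Qed.

(** * Asymptotics of binomial coefficients *)

(** Divided by (r + s)^(r + s), the terms are binomial probabilities with success rate r / (r + s),
    whose mode is r: with n = r + s, the ratio (n - i) r / ((i + 1) s) of consecutive terms is at
    least 1 for i < r and at most 1 afterwards. *)
Lemma bin_mode_le (r s k : nat) : (0 < r)%N -> (0 < s)%N -> (k <= r + s)%N ->
  ('C(r + s, k) * (r ^ k * s ^ (r + s - k)) <= 'C(r + s, r) * (r ^ r * s ^ s))%N.
Proof.
move=> r0 s0; set n := (r + s)%N; pose t k := ('C(n, k) * (r ^ k * s ^ (n - k)))%N.
have tS i : (i < n)%N -> (i.+1 * s * t i.+1 = (n - i) * r * t i)%N.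
  move=> i_n; rewrite /t (_ : (n - i = (n - i.+1).+1)%N); last lia.
  have := mul_bin_left n i; rewrite (_ : (n - i = (n - i.+1).+1)%N); last lia.
  rewrite !expnS => E.
  transitivity ((i.+1 * 'C(n, i.+1)) * (r * r ^ i * (s * s ^ (n - i.+1))))%N; first by ring.
  by rewrite E; ring.
have t_incr i : (i < r)%N -> (t i <= t i.+1)%N.
  move=> ir; rewrite -(@leq_pmul2l (i.+1 * s)) ?muln_gt0 //= tS; last by rewrite /n; lia.
  by apply: leq_mul => //; rewrite /n; nia.
have t_decr i : (r <= i < n)%N -> (t i.+1 <= t i)%N.
  case/andP=> ri i_n; rewrite -(@leq_pmul2l (i.+1 * s)) ?muln_gt0 //= tS //.
  by apply: leq_mul => //; rewrite /n; nia.
have -> : ('C(n, r) * (r ^ r * s ^ s) = t r)%N by rewrite /t /n addKn.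
rewrite -/(t k) => kn; case: (leqP k r) => [kr|/ltnW rk].
  rewrite -(subKn kr); elim: (r - k)%N (leq_subr k r) => [|d IH] dr; first by rewrite subn0.
  apply: leq_trans (IH (ltnW dr)); have -> : (r - d = (r - d.+1).+1)%N by lia.
  by apply: t_incr; lia.
rewrite -(subnKC rk); have : (r + (k - r) <= n)%N by rewrite subnKC.
elim: (k - r)%N => [|d IH] dn; first by rewrite addn0.
apply: leq_trans (IH _); last lia.
by rewrite addnS; apply: t_decr; lia.
Qed.

(** The expansion of (r + s)^n with n = r + s has n + 1 terms, and its largest term is the one at
    r. *)
Lemma bin_entropy_nat (r s : nat) : (0 < r)%N -> (0 < s)%N ->
  ('C(r + s, r) * (r ^ r * s ^ s) <= (r + s) ^ (r + s)
     <= (r + s).+1 * ('C(r + s, r) * (r ^ r * s ^ s)))%N.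
Proof.
move=> r0 s0; set n := (r + s)%N.
have -> : (n ^ n = \sum_(k < n.+1) 'C(n, k) * (r ^ k * s ^ (n - k)))%N.
  by rewrite {1}/n addnC expnDn; apply: eq_bigr => k _; rewrite (mulnC (s ^ _)%N).
apply/andP; split.
  have rn : (r < n.+1)%N by rewrite ltnS leq_addr.
  by rewrite (bigD1 (Ordinal rn)) //= {2}/n addKn leq_addr.
apply: leq_trans (_ : \sum_(k < n.+1) ('C(n, r) * (r ^ r * s ^ s)) <= _)%N; last first.
  by rewrite sum_nat_const card_ord.
by apply: leq_sum => k _; apply: bin_mode_le => //; rewrite -ltnS.
Qed.

(** The negative of the binary Shannon entropy; for 0 < p < 1 it is the logarithm of [Kconst p]. *)
Definition entropy {R : realType} (p : R) : R := p * ln p + (1 - p) * ln (1 - p).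

Lemma ln_nat_exp (R : realType) k m : (0 < k)%N ->
  ln (k%:R ^+ m : R) = m%:R * ln k%:R.
Proof. by move=> k0; rewrite lnXn ?ltr0n // mulr_natl. Qed.

Lemma ln_bin_entropy (R : realType) (r n : nat) : (0 < r < n)%N ->
  - (ln n.+1%:R / n%:R) <= ln 'C(n, r)%:R / n%:R + entropy (r%:R / n%:R : R) <= 0.
Proof.
case/andP => r0 rn; have [s s0 nE] : exists2 s, (0 < s)%N & n = (r + s)%N.
  by exists (n - r)%N; lia.
have n0 : (0 < n)%N by lia.
have nR : n%:R = r%:R + s%:R :> R by rewrite nE natrD.
have nR0 : (n%:R : R) != 0 by rewrite pnatr_eq0 -lt0n.
have -> : ln 'C(n, r)%:R / n%:R + entropy (r%:R / n%:R) =
   (ln 'C(n, r)%:R + r%:R * ln r%:R + s%:R * ln s%:R - n%:R * ln n%:R) / n%:R :> R.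
  rewrite /entropy (_ : 1 - r%:R / n%:R = s%:R / n%:R); last first.
    by rewrite -[X in X - _](divff nR0) -mulrBl {1}nR addrC addKr.
  rewrite !lnM ?lnV ?posrE ?invr_gt0 ?ltr0n //; set L := ln n%:R.
  have -> : n%:R * L = (r%:R + s%:R) * L by rewrite nR.
  by field.
have := bin_entropy_nat r0 s0; rewrite -nE => /andP[lo hi].
have Cpos : (0 < 'C(n, r))%N by rewrite bin_gt0; lia.
have lnP : ln (('C(n, r) * (r ^ r * s ^ s))%:R : R) =
    ln 'C(n, r)%:R + r%:R * ln r%:R + s%:R * ln s%:R.
  rewrite !natrM !natrX !lnM ?posrE ?mulr_gt0 ?exprn_gt0 ?ltr0n //.
  by rewrite !ln_nat_exp // addrA.
have prod0 : (0 < 'C(n, r) * (r ^ r * s ^ s))%N by rewrite !muln_gt0 Cpos !expn_gt0 r0 s0.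
have lnn : ln ((n ^ n)%:R : R) = n%:R * ln n%:R by rewrite natrX ln_nat_exp.
apply/andP; split; last first.
  rewrite pmulr_lle0 ?invr_gt0 ?ltr0n // subr_le0 -lnP -lnn.
  by rewrite ler_ln ?posrE ?ltr0n ?expn_gt0 ?n0 // ler_nat.
rewrite -mulNr ler_pM2r ?invr_gt0 ?ltr0n // lerBrDl lerBlDr -lnP -lnn addrC.
rewrite -lnM ?posrE ?ltr0n // -natrM.
by rewrite ler_ln ?posrE ?ltr0n ?expn_gt0 ?n0 ?(muln_gt0 n.+1) // ler_nat.
Qed.

Lemma ln_div_nat_cvg (R : realType) : (ln n.+1%:R / n%:R : R) @[n --> \oo] --> (0 : R).
Proof.
have sq : (4 * Num.sqrt n%:R^-1 : R) @[n --> \oo] --> (0 : R).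
  have inv0 : (n%:R^-1 : R) @[n --> \oo] --> (0 : R).
    apply/gtr0_cvgV0; first by near=> n; rewrite ltr0n; near: n; exact: nbhs_infty_gt.
    exact: cvgr_idn.
  rewrite -(mulr0 4) -(sqrtr0 R); apply: cvgM; first exact: cvg_cst.
  by apply: (cvg_comp _ _ inv0); exact: sqrt_continuous.
apply: squeeze_cvgr sq; last exact: cvg_cst.
near=> n; have n0 : (0 < n)%N by near: n; exact: nbhs_infty_gt.
have lt0 : 0 <= ln n.+1%:R :> R by rewrite ln_ge0 // ler1n.
rewrite divr_ge0 //= ler_pdivrMr ?ltr0n //.
have -> : 4 * Num.sqrt n%:R^-1 * n%:R = 4 * Num.sqrt n%:R :> R.
  rewrite sqrtrV ?ler0n // -{2}(sqr_sqrtr (ler0n R n)) expr2 -mulrA mulKf //.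
  by rewrite sqrtr_eq0 -ltNge ltr0n.
have s0 : 0 < Num.sqrt n.+1%:R :> R by rewrite sqrtr_gt0 ltr0n.
(* The chain is ln (n + 1) = 2 ln (sqrt (n + 1)) <= 2 sqrt (n + 1) <= 4 sqrt n, the last step
   because n >= 1. *)
rewrite -{1}(sqr_sqrtr (ler0n R n.+1)) lnXn // -[ln _ *+ 2]mulr_natl.
apply: (@le_trans _ _ (2 * Num.sqrt n.+1%:R)).
  by rewrite ler_pM2l ?ltr0n // ltW // ln_sublinear.
have -> : 4 = 2 * 2 :> R by rewrite -natrM.
rewrite -mulrA ler_pM2l ?ltr0n //.
rewrite -(@ler_pXn2r _ 2%N) ?nnegrE ?mulr_ge0 ?sqrtr_ge0 // exprMn !sqr_sqrtr ?ler0n //.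
rewrite -natrX -natrM ler_nat; lia.
Unshelve. all: by end_near.
Qed.

(** * The level function whose zero set is the curve *)

(** The logarithm of |z|^alpha / (|1 + z| Kconst alpha). It is the limit of 1/n times the logarithm
    of m(z) / |1 + z|^n, so its sign tells which of the two dominates. As ln 0 is 0 by default, this
    reading holds only away from 0 and -1. *)
Definition level {R : realType} (alpha : R) (z : R[i]) : R :=
  alpha * ln (cmod z) - ln (cmod (1 + z)) - entropy alpha.

Lemma Kconst_gt0 (R : realType) (alpha : R) : 0 < alpha < 1 -> 0 < Kconst alpha.
Proof. by case/andP=> a0 a1; rewrite mulr_gt0 ?powR_gt0 // subr_gt0. Qed.

Lemma ln_Kconst (R : realType) (alpha : R) : 0 < alpha < 1 ->
  ln (Kconst alpha) = entropy alpha.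
Proof.
by case/andP=> a0 a1; rewrite lnM ?posrE ?powR_gt0 ?subr_gt0 // !ln_powR.
Qed.

(** At 0 the power vanishes, at -1 the convention x / 0 = 0 applies: in both cases the quotient is
    0, whereas the constant is positive. *)
Lemma Ccurve_neq (R : realType) (alpha : R) (z : R[i]) : 0 < alpha < 1 ->
  Ccurve alpha z -> 0 < cmod z /\ 0 < cmod (1 + z).
Proof.
move=> a01 [zK _]; have K0 := Kconst_gt0 a01; have /andP[a0 _] := a01.
rewrite !lt_def !cmod_ge0 !andbT; split; apply: contraTneq K0 => z0.
  by rewrite -zK z0 powR0 ?gt_eqF // mul0r ltxx.
by rewrite -zK z0 invr0 mulr0 ltxx.
Qed.

Lemma CcurveP (R : realType) (alpha : R) (z : R[i]) : 0 < alpha < 1 ->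
  0 < cmod z -> 0 < cmod (1 + z) ->
  Ccurve alpha z <-> level alpha z = 0 /\ cmod z <= alpha / (1 - alpha).
Proof.
move=> a01 z0 z1; have K0 := Kconst_gt0 a01.
have lnq : ln (cmod z `^ alpha / cmod (1 + z)) = level alpha z + entropy alpha.
  by rewrite /level subrK lnM ?posrE ?invr_gt0 ?powR_gt0 // lnV ?posrE // ln_powR.
split=> -[zK za]; split=> //.
  by move/eqP: lnq; rewrite zK ln_Kconst // -subr_eq subrr => /eqP <-.
apply: (@ln_inj R); rewrite ?posrE ?divr_gt0 ?powR_gt0 //.
by rewrite lnq zK add0r ln_Kconst.
Qed.

Lemma entropy_cvg (R : realType) (p : nat -> R) (alpha : R) : 0 < alpha < 1 ->
  p j @[j --> \oo] --> alpha -> entropy (p j) @[j --> \oo] --> entropy alpha.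
Proof.
case/andP=> a0 a1 pa; have qa : 1 - p j @[j --> \oo] --> 1 - alpha.
  by apply: cvgB => //; exact: cvg_cst.
have ln_p : ln (p j) @[j --> \oo] --> ln alpha.
  by apply: (cvg_comp _ _ pa); exact: continuous_ln.
have ln_q : ln (1 - p j) @[j --> \oo] --> ln (1 - alpha).
  by apply: (cvg_comp _ _ qa); apply: continuous_ln; rewrite subr_gt0.
by apply: cvgD; exact: cvgM.
Qed.

(** * Logarithmic asymptotics of the zeros *)

Section Asymptotics.
Context (R : realType) (r n : nat -> nat) (alpha : R)
  (rn_bound : forall j, (1 <= r j)%N /\ (r j < n j - 1)%N)
  (n_infty : n j @[j --> \oo] --> \oo)
  (ratio_cvg : (r j)%:R / (n j)%:R @[j --> \oo] --> alpha)
  (alpha01 : 0 < alpha < 1).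

Let p j : R := (r j)%:R / (n j)%:R.
Let a : R := alpha / (1 - alpha).

Lemma n_gt0 j : 0 < (n j)%:R :> R.
Proof. by rewrite ltr0n; case: (rn_bound j) => _; clear; case: (n j). Qed.

Lemma ln_succ_div_cvg : (ln (n j).+1%:R / (n j)%:R : R) @[j --> \oo] --> (0 : R).
Proof. exact: cvg_comp n_infty (@ln_div_nat_cvg R). Qed.

Lemma n_inv_cvg : ((n j)%:R^-1 : R) @[j --> \oo] --> (0 : R).
Proof.
apply/gtr0_cvgV0; first by near=> j; exact: n_gt0.
exact: cvg_comp n_infty (@cvgr_idn R).
Unshelve. all: by end_near.
Qed.

Lemma ln_bin_cvg :
  (ln 'C(n j, r j)%:R / (n j)%:R : R) @[j --> \oo] --> - entropy alpha.
Proof.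
have Hp := entropy_cvg alpha01 ratio_cvg.
rewrite -[X in _ --> X]add0r.
have -> : (fun j => ln 'C(n j, r j)%:R / (n j)%:R : R) =
   (fun j => (ln 'C(n j, r j)%:R / (n j)%:R + entropy (p j)) - entropy (p j)).
  by apply/funext => j; rewrite addrK.
apply: cvgB => //; apply: (@squeeze_cvgr _ _ _ _
  (fun j => - (ln (n j).+1%:R / (n j)%:R)) (fun=> 0)).
- near=> j; apply: ln_bin_entropy; have [] := rn_bound j; clear; lia.
- by rewrite -oppr0; apply: cvgN; exact: ln_succ_div_cvg.
- exact: cvg_cst.
Unshelve. all: by end_near.
Qed.

(* Taking logarithms in [Bpoly_zero_bounds] and dividing by [n]. *)
Lemma zeros_near_level : exists2 sigma : R, 0 < sigma & forall eps : R, 0 < eps ->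
  \forall j \near \oo, forall z, root (Bpoly R (r j) (n j)) z ->
  [/\ sigma <= cmod z, cmod z <= a + eps, 0 < cmod (1 + z) & `|level alpha z| <= eps].
Proof.
have /andP[al0 al1] := alpha01; have Hb := ln_bin_cvg; have Hn := ln_succ_div_cvg.
have Hi := n_inv_cvg; have H0 : entropy alpha <= 0.
  rewrite /entropy; have ln0 x : 0 < x < 1 -> ln x <= 0 :> R.
    by case/andP=> x0 x1; rewrite ln_le0 // ltW.
  have := ln0 _ alpha01; have : ln (1 - alpha) <= 0 by apply: ln0; lra.
  by nra.
(* The term |ln |z|| / n comes from the extra factor |z| in the lower bound; the constant 4 covers
   ln 2 + 3 ln n <= 4 ln (n + 1). *)
have logs j z : root (Bpoly R (r j) (n j)) z -> 0 < cmod (1 + z) /\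
    `|p j * ln (cmod z) - ln (cmod (1 + z)) + ln 'C(n j, r j)%:R / (n j)%:R|
      <= `|ln (cmod z)| * (n j)%:R^-1 + 4 * (ln (n j).+1%:R / (n j)%:R).
  move=> Bz; have [r1 rn] := rn_bound j; have n0 := n_gt0 j.
  have n1 : (1 < (n j).+1)%N by clear -rn; lia.
  have rn2 : ((r j).+2 <= n j)%N by clear -rn; lia.
  have x0 : 0 < cmod z by rewrite cmod_gt0 (Bpoly_zero_neq0 Bz).
  have C0 : 0 < 'C(n j, r j)%:R :> R by rewrite ltr0n bin_gt0 ltnW // ltnW.
  have /andP[lo hi] := Bpoly_zero_bounds r1 rn2 Bz.
  have Cx0 : 0 < 'C(n j, r j)%:R * cmod z ^+ r j by rewrite mulr_gt0 ?exprn_gt0.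
  have d0 : 0 < 2 * (n j)%:R ^+ 3 :> R by rewrite mulr_gt0 ?exprn_gt0.
  have un0 : 0 < cmod (1 + z) ^+ n j.
    by apply: lt_le_trans lo; rewrite mulr_gt0 // divr_gt0.
  have u0 : 0 < cmod (1 + z).
    rewrite lt_def cmod_ge0 andbT; apply: contraTneq un0 => ->.
    by rewrite expr0n; case: (n j) rn2 => // m _; rewrite ltxx.
  split=> //.
  have lnu : ln (cmod (1 + z) ^+ n j) = (n j)%:R * ln (cmod (1 + z)).
    by rewrite lnXn // mulr_natl.
  have lnCx : ln ('C(n j, r j)%:R * cmod z ^+ r j) = ln 'C(n j, r j)%:R + (r j)%:R * ln (cmod z).
    by rewrite lnM ?posrE ?exprn_gt0 // lnXn // mulr_natl.
  have lnS0 : 0 <= ln (n j).+1%:R :> R by rewrite ln_ge0 // ler1n.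
  have lnle : ln (n j)%:R <= ln (n j).+1%:R :> R by rewrite ler_ln ?posrE // ler_nat.
  have ln2 : ln 2 <= ln (n j).+1%:R :> R.
    by rewrite ler_ln ?posrE ?ltr0Sn // (ler_nat R 2).
  have hi' : (n j)%:R * ln (cmod (1 + z)) <=
      ln (n j)%:R + (ln 'C(n j, r j)%:R + (r j)%:R * ln (cmod z)).
    by rewrite -lnu -lnCx -lnM ?posrE // ler_ln ?posrE // mulr_gt0.
  have lo' : ln 'C(n j, r j)%:R + (r j)%:R * ln (cmod z) +
      (ln (cmod z) - (ln 2 + 3 * ln (n j)%:R)) <= (n j)%:R * ln (cmod (1 + z)).
    rewrite -lnu -lnCx.
    have -> : ln (cmod z) - (ln 2 + 3 * ln (n j)%:R) = ln (cmod z / (2 * (n j)%:R ^+ 3)).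
      by rewrite [RHS]lnM ?lnV ?posrE ?invr_gt0 // lnM ?posrE ?exprn_gt0 // lnXn // -[ln _ *+ 3]mulr_natl.
    by rewrite -lnM ?posrE ?divr_gt0 // ler_ln ?posrE // mulr_gt0 // divr_gt0.
  have -> : p j * ln (cmod z) - ln (cmod (1 + z)) + ln 'C(n j, r j)%:R / (n j)%:R =
     ((r j)%:R * ln (cmod z) - (n j)%:R * ln (cmod (1 + z)) + ln 'C(n j, r j)%:R) / (n j)%:R.
    by rewrite /p; field; rewrite gt_eqF.
  rewrite mulrA -mulrDl normrM [`|_^-1|]gtr0_norm ?invr_gt0 // ler_pM2r ?invr_gt0 //.
  have := ler_norm (ln (cmod z)); have := ler_norm (- ln (cmod z)); rewrite normrN.
  by rewrite ler_norml; lra.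
(* Zeros stay away from 0: if |z| < 1/2 then ln |1 + z| >= -1, and the estimate [logs] then prevents
   alpha ln |z| from being below 4 (entropy alpha - 3). *)
pose sigma : R := Num.min 2^-1 (expR (4 * (entropy alpha - 3) / alpha)).
have sigma0 : 0 < sigma by rewrite lt_min expR_gt0 invr_gt0 ltr0n.
exists sigma => // eps eps0.
have a0 : 0 < a by rewrite divr_gt0 // subr_gt0.
pose M : R := `|ln sigma| + `|ln (a + 1)|.
have M0 : 0 <= M by rewrite addr_ge0.
(* The bounds 1/8 and alpha / 4 serve the lower bound sigma. In the final estimate |ln |z|| <= M,
   and the errors add up to d (2 M + 5): M d from p, M d from 1/n, 4 d from ln (n + 1) / n and d
   from the binomial. *)
pose d : R := Num.min (Num.min 8^-1 (alpha / 4)) (eps / (2 * M + 5)).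
have d0 : 0 < d by rewrite !lt_min invr_gt0 ltr0n !divr_gt0 //; lra.
pose eps1 : R := Num.min eps 1.
have eps10 : 0 < eps1 by rewrite lt_min eps0 ltr01.
have Hq : p j / (1 - p j) @[j --> \oo] --> a.
  apply: cvgM => //; apply: cvgV; first by rewrite gt_eqF // subr_gt0.
  by apply: cvgB => //; exact: cvg_cst.
near=> j => z Bz.
have [u0 Llog] := logs j z Bz.
have [r1 rn] := rn_bound j; have n0 := n_gt0 j.
have rn2 : ((r j).+2 <= n j)%N by clear -rn; lia.
have x0 : 0 < cmod z by rewrite cmod_gt0 (Bpoly_zero_neq0 Bz).
have pa : `|alpha - p j| <= d by near: j; exact: cvgr_dist_le.
have cH : `|- entropy alpha - ln 'C(n j, r j)%:R / (n j)%:R| <= d.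
  by near: j; exact: cvgr_dist_le.
have ld : ln (n j).+1%:R / (n j)%:R <= d.
  by rewrite (le_trans (ler_norm _)) //; near: j; exact: cvgr0_norm_le.
have id : (n j)%:R^-1 <= d :> R.
  by rewrite (le_trans (ler_norm _)) //; near: j; exact: cvgr0_norm_le.
(* The radius r / (n - r + 1) is at most r / (n - r) = p / (1 - p), whose limit is a. *)
have xa : cmod z <= a + eps1.
  apply: (@le_trans _ _ (p j / (1 - p j))).
    have -> : p j / (1 - p j) = (r j)%:R / (n j - r j)%:R.
      have -> : 1 - p j = (n j - r j)%:R / (n j)%:R.
        by rewrite natrB ?mulrBl ?divff ?lt0r_neq0 // ltnW // ltnW.
      by rewrite /p invf_div mulrA divfK // lt0r_neq0.
    apply: le_trans (Bpoly_zero_le _ Bz) _; first by rewrite r1 ltnW // ltnW.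
    rewrite ler_wpM2l // lef_pV2 ?posrE ?ltr0n ?subn_gt0 // ?ler_nat //.
    exact: ltnW.
  rewrite -lerBlDl (le_trans (ler_norm _)) // distrC; near: j; exact: cvgr_dist_le.
have inv0 : 0 < (n j)%:R^-1 :> R by rewrite invr_gt0.
have d8 : d <= 8^-1 by rewrite /d !ge_min lexx.
have d4 : d <= alpha / 4 by rewrite /d !ge_min lexx orbT.
have deps : d * (2 * M + 5) <= eps.
  by rewrite -ler_pdivlMr ?ge_min ?lexx ?orbT //; lra.
move: pa cH Llog; set c := ln 'C(_, _)%:R / _; set l := ln _.+1%:R / _ in ld *.
set x := cmod z in x0 xa *; set u := cmod (1 + z) in u0 *.
set i : R := (n j)%:R^-1 in id inv0 *.
move=> pa cH Llog.
have xs : sigma <= x.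
  rewrite leNgt; apply/negP; rewrite lt_min => /andP[x2 xe].
  have lnx : ln x < 4 * (entropy alpha - 3) / alpha.
    by rewrite -(expRK (4 * (entropy alpha - 3) / alpha)) ltr_ln ?posrE ?expR_gt0.
  have {}lnx : alpha * ln x < 4 * (entropy alpha - 3).
    by rewrite mulrC -ltr_pdivlMr.
  have u2 : 2^-1 <= u.
    have : 1 - x <= u by rewrite -(cmod1 R) /x /u cmodD_ge.
    by lra.
  have lnu : - 1 <= ln u.
    have : ln 2^-1 <= ln u by rewrite ler_ln ?posrE ?invr_gt0 ?ltr0n.
    have : ln (1 + 1) <= 1 :> R by apply: le_ln1Dx; lra.
    by rewrite lnV ?posrE ?ltr0n // (_ : 1 + 1 = 2) //; lra.
  have lnx0 : ln x <= 0 by rewrite ln_le0 //; lra.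
  move: Llog pa cH; rewrite (ler0_norm lnx0) !ler_norml.
  by move=> /andP[L1 L2] /andP[p1 p2] /andP[c1 c2]; nra.
split=> //; first by rewrite (le_trans xa) // lerD2l ge_min lexx.
have lnxM : `|ln x| <= M.
  have xa1 : x <= a + 1 by rewrite (le_trans xa) // lerD2l ge_min lexx orbT.
  have : ln sigma <= ln x by rewrite ler_ln.
  have : ln x <= ln (a + 1) by rewrite ler_ln ?posrE //; lra.
  rewrite /M; have := ler_norm (ln (a + 1)); have := ler_norm (- ln sigma); rewrite normrN.
  by have := normr_ge0 (ln sigma); have := normr_ge0 (ln (a + 1)); rewrite ler_norml; lra.
have -> : level alpha z = (p j * ln x - ln u + c) + (alpha - p j) * ln x + (- entropy alpha - c).
  by rewrite /level -/x -/u; ring.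
apply: le_trans deps; apply: le_trans (ler_normD _ _) _.
have H1 : `|(alpha - p j) * ln x| <= d * M by rewrite normrM ler_pM.
have H2 : `|ln x| * i <= M * d by rewrite ler_pM // ltW.
have := ler_normD (p j * ln x - ln u + c) ((alpha - p j) * ln x).
by lra.
Unshelve. all: by end_near.
Qed.

End Asymptotics.

(** * Convergence of the zeros to the curve *)

(** The compactness argument takes place in [R * R], with the real and imaginary parts as
    coordinates. *)
Lemma cmod_pair_continuous (R : realType) (w : R[i]) :
  continuous (fun q : R * R => cmod (Complex q.1 q.2 - w)).
Proof.
have -> : (fun q : R * R => cmod (Complex q.1 q.2 - w)) =
  (fun q => Num.sqrt ((q.1 - complex.Re w) ^+ 2 + (q.2 - complex.Im w) ^+ 2)).
  by apply/funext => q; rewrite cmodE cReB cImB.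
move=> q; apply: continuous_comp; last exact: sqrt_continuous.
have H (f : R * R -> R) (c : R) : f @ q --> f q -> (f x - c) ^+ 2 @[x --> q] --> (f q - c) ^+ 2.
  by move=> fq; rewrite expr2; apply: cvgM; apply: cvgB => //; exact: cvg_cst.
by apply: cvgD; apply: H; [exact: cvg_fst | exact: cvg_snd].
Qed.

(* A continuous function vanishing on a compact set exactly where the curve is
   cannot be small away from it. *)
Lemma level_small_near_curve (R : realType) (alpha sigma delta : R) :
  0 < alpha < 1 -> 0 < sigma -> 0 < delta ->
  exists2 eta : R, 0 < eta & forall z : R[i],
    sigma <= cmod z -> cmod z <= alpha / (1 - alpha) + eta -> 0 < cmod (1 + z) ->
    `|level alpha z| <= eta -> exists2 zeta, Ccurve alpha zeta & cmod (z - zeta) < delta.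
Proof.
move=> a01 s0 d0; have /andP[al0 al1] := a01; set a := alpha / (1 - alpha).
pose toC (q : R * R) : R[i] := Complex q.1 q.2.
(* A level of at most 1 together with |z| >= sigma forces |1 + z| >= tau; this keeps the compact set
   away from -1, where the logarithm is not continuous. *)
pose tau : R := expR (alpha * ln sigma - entropy alpha - 1).
have cont0 : continuous (fun q => cmod (toC q)).
  have -> : (fun q => cmod (toC q)) = (fun q => cmod (Complex q.1 q.2 - 0)).
    by apply/funext => q; rewrite subr0.
  exact: cmod_pair_continuous.
have cont1 : continuous (fun q => cmod (1 + toC q)).
  have -> : (fun q => cmod (1 + toC q)) = (fun q => cmod (Complex q.1 q.2 - (- 1))).
    by apply/funext => q; rewrite opprK addrC.
  exact: cmod_pair_continuous.
pose A : set (R * R) := ([set q | sigma <= cmod (toC q)] `&` [set q | cmod (toC q) <= a + 1])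
  `&` ([set q | tau <= cmod (1 + toC q)] `&`
       \bigcap_(zeta in Ccurve alpha) [set q | delta <= cmod (toC q - zeta)]).
have Acl : closed A.
  apply: closedI; apply: closedI.
  - by apply: (preimage_closed _ (@closed_ge _ _)) => q _; exact: (cont0 q).
  - by apply: (preimage_closed _ (@closed_le _ _)) => q _; exact: (cont0 q).
  - by apply: (preimage_closed _ (@closed_ge _ _)) => q _; exact: (cont1 q).
  - apply: closed_bigI => zeta _.
    by apply: (preimage_closed _ (@closed_ge _ _)) => q _; exact: (@cmod_pair_continuous R zeta q).
have Acpt : compact A.
  apply: (@subclosed_compact _ _ (`[- (a + 1), a + 1] `*` `[- (a + 1), a + 1])) => //.
    by apply: compact_setX; exact: segment_compact.
  move=> q [[_ /= qa] _].
  have := le_trans (Re_le_cmod (toC q)) qa; have := le_trans (Im_le_cmod (toC q)) qa.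
  by rewrite !ler_norml /= !in_itv /=.
(* The second summand is twice the positive part of |z| - a, so on [A] a zero of h would be a point
   of the curve. [A] contains none, and its compact image under h therefore misses a neighbourhood
   of 0. *)
pose h q : R := `|level alpha (toC q)| + ((cmod (toC q) - a) + `|cmod (toC q) - a|).
have hcont : {within A, continuous h}.
  apply: continuous_in_subspaceT => q /set_mem [[/= q1 q2] [/= q3 q4]].
  have tau0 : 0 < tau by exact: expR_gt0.
  have c1 : cmod (toC x) - a @[x --> q] --> cmod (toC q) - a.
    by apply: cvgB; [exact: cont0 | exact: cvg_cst].
  apply: cvgD; last by apply: cvgD => //; exact: cvg_norm.
  apply: cvg_norm; apply: cvgB; last exact: cvg_cst.
  apply: cvgB; first (apply: cvgM; first exact: cvg_cst).
    apply: continuous_comp; first exact: cont0.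
    by apply: continuous_ln; exact: lt_le_trans q1.
  apply: continuous_comp; first exact: cont1.
  by apply: continuous_ln; exact: lt_le_trans q3.
have hAcl : closed (h @` A) by apply: compact_closed (continuous_compact hcont Acpt).
have h0 : ~ (h @` A) 0.
  move=> [q [[/= q1 q2] [/= q3 q4]] hq].
  have tau0 : 0 < tau by exact: expR_gt0.
  have qC : Ccurve alpha (toC q).
    apply/CcurveP => //; [exact: lt_le_trans q1|exact: lt_le_trans q3|].
    move: hq; rewrite /h => hq.
    have n1 := normr_ge0 (level alpha (toC q)).
    have n2 := ler_norm (- (cmod (toC q) - a)).
    have n3 := ler_norm (cmod (toC q) - a); rewrite normrN in n2.
    split; last by rewrite -/a; lra.
    by apply/eqP; rewrite -normr_eq0; apply/eqP; lra.
  by move: (q4 _ qC); rewrite /mkset subrr cmod0 leNgt d0.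
have /nbhs_ballP[e /= e0 he] : nbhs (0 : R) (~` (h @` A)).
  by apply: open_nbhs_nbhs; split => //; exact: closed_openC.
(* The bound 1 places the point in [A]; the bound e / 4 makes h at most e / 4 + e / 2 < e there. *)
exists (Num.min 1 (e / 4)); first by rewrite lt_min ltr01 divr_gt0.
move=> z z1 z2 z3 z4; apply: contrapT => zC.
set eta := Num.min _ _ in z2 z4.
have eta1 : eta <= 1 by rewrite ge_min lexx.
have eta2 : eta <= e / 4 by rewrite ge_min lexx orbT.
have zE : toC (complex.Re z, complex.Im z) = z by rewrite /toC; case: (z).
have zA : A (complex.Re z, complex.Im z).
  split; split.
  - by rewrite /mkset zE.
  - by rewrite /mkset zE (le_trans z2) // lerD2l.
  - rewrite /mkset zE /tau -ler_ln ?posrE ?expR_gt0 // expRK.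
    move: z4; rewrite /level ler_norml => /andP[_].
    have : alpha * ln sigma <= alpha * ln (cmod z).
      by rewrite ler_pM2l // ler_ln ?posrE //; exact: lt_le_trans z1.
    by lra.
  - by move=> zeta Czeta; rewrite /mkset zE leNgt; apply/negP => lt; apply: zC; exists zeta.
apply: (he (h (complex.Re z, complex.Im z))); last by exists (complex.Re z, complex.Im z).
rewrite /ball /= sub0r normrN /h zE.
have za : cmod z - a <= e / 4 by rewrite lerBlDl (le_trans z2) // lerD2l.
set t := cmod z - a in za *; set l := `|level _ _| in z4 *.
have t0 : 0 <= t + `|t| by have := ler_norm (- t); rewrite normrN; lra.
rewrite ger0_norm; last by rewrite addr_ge0 ?normr_ge0.
have te : t + `|t| <= e / 2.
  have [tp|tn] := lerP 0 t; first by rewrite ger0_norm //; lra.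
  by rewrite ltr0_norm // subrr; lra.
by lra.
Qed.

Lemma zeros_sup_dist_cvg (R : realType) (r n : nat -> nat) (alpha : R)
    (rn_bound : forall j, (1 <= r j)%N /\ (r j < n j - 1)%N)
    (n_infty : n j @[j --> \oo] --> \oo)
    (ratio_cvg : (r j)%:R / (n j)%:R @[j --> \oo] --> alpha)
    (alpha01 : 0 < alpha < 1) :
  sup_dist (zeros (Bpoly R (r j) (n j))) (Ccurve alpha) @[j --> \oo] --> 0%E.
Proof.
have [sigma s0 Hz] := zeros_near_level rn_bound n_infty ratio_cvg alpha01.
have near_curve (eps : R) : 0 < eps -> \forall j \near \oo,
    (0 <= sup_dist (zeros (Bpoly R (r j) (n j))) (Ccurve alpha) <= eps%:E)%E.
  move=> e0; have [eta eta0 Heta] := level_small_near_curve alpha01 s0 e0.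
  have := Hz eta eta0; apply: filterS => j Hj; apply/andP; split.
    (* A zero must exist here: the supremum over an empty set would be -oo. *)
    have [r1 rn] := rn_bound j.
    have [|z Bz] := @Bpoly_root R (r j) (n j); first by rewrite r1; clear -rn; lia.
    apply: le_trans (_ : (dist_to (Ccurve alpha) z <= _)%E).
      by apply: le_ereal_inf_tmp => _ [zeta _ <-]; rewrite lee_fin cmod_ge0.
    by apply: ereal_sup_ubound; exists z.
  apply: ge_ereal_sup => _ [z Bz <-].
  have [z1 z2 z3 z4] := Hj z Bz; have [zeta Cz zz] := Heta z z1 z2 z3 z4.
  apply: le_trans (_ : ((cmod (z - zeta))%:E <= _)%E); last by rewrite lee_fin ltW.
  by apply: ereal_inf_lbound; exists zeta.
apply: cvg_EFin.
  have := near_curve 1 ltr01; apply: filterS => j /andP[lo hi].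
  by rewrite fin_numElt (lt_le_trans _ lo) ?ltNyr // (le_lt_trans hi) ?ltry.
apply/cvgr0Pnorm_le => e e0; have := near_curve e e0; apply: filterS => j /= /andP[lo hi].
have fin : sup_dist (zeros (Bpoly R (r j) (n j))) (Ccurve alpha) \is a fin_num.
  by rewrite fin_numElt (lt_le_trans _ lo) ?ltNyr // (le_lt_trans hi) ?ltry.
by rewrite ger0_norm ?fine_ge0 // -lee_fin fineK.
Qed.

(** * The quotient detecting the absence of zeros *)

(* [quot r n z = 1 - (1 + z) B'(z) / (n B(z))]: it is the logarithmic derivative
   of [B] up to an affine change, so it is Lipschitz away from the zeros. *)
Definition quot (R : realType) (r n : nat) (z : R[i]) : R[i] :=
  (n - r)%:R * 'C(n, r)%:R * z ^+ r / (n%:R * (Bpoly R r n).[z]).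

(** By [Bpoly_deriv], [quot] is 1 - (1 + z) F(z), where F is 1/n times the sum of 1 / (z - w) over
    the zeros w. Each summand is at most 2 / delta in modulus and Lipschitz with constant (2 /
    delta)^2; as there are r <= n of them, neither bound depends on n. *)
Lemma quot_lipschitz (R : realType) (r n : nat) (zeta z1 z2 : R[i]) (delta : R) :
  (0 < n)%N -> (r <= n)%N -> 0 < delta ->
  (forall w, root (Bpoly R r n) w -> delta <= cmod (w - zeta)) ->
  cmod (z1 - zeta) <= delta / 2 -> cmod (z2 - zeta) <= delta / 2 ->
  cmod (quot r n z1 - quot r n z2) <=
    cmod (z1 - z2) * (cmod (1 + z2) * (2 / delta) ^+ 2 + 2 / delta).
Proof.
move=> n0 rn d0 far h1 h2; have [s ss Bs] := Bpoly_split R rn.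
have nC0 : n%:R != 0 :> R[i] by rewrite pnatr_eq0 -lt0n.
have far_s w : w \in s -> delta <= cmod (w - zeta).
  move=> ws; apply: far; rewrite Bs rootZ ?root_prod_XsubC //.
  by rewrite lead_coef_eq0 -size_poly_eq0 size_Bpoly.
have near_s z w : cmod (z - zeta) <= delta / 2 -> w \in s -> delta / 2 <= cmod (z - w).
  move=> hz /far_s; have := cmodB_ge (w - zeta) (z - zeta).
  rewrite (_ : w - zeta - (z - zeta) = w - z); last by ring.
  by rewrite (cmodB w z); lra.
have d20 : 0 < delta / 2 by rewrite divr_gt0.
pose F z := (\sum_(w <- s) (z - w)^-1) / n%:R.
have quotE z : cmod (z - zeta) <= delta / 2 -> quot r n z = 1 - (1 + z) * F z.
  move=> hz; have Bz0 : (Bpoly R r n).[z] != 0.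
    apply/negP => /far; rewrite leNgt (le_lt_trans hz) // ltr_pdivrMr // ltr_pMr //.
    by rewrite ltr1n.
  have zs : z \notin s.
    by apply/negP => /(near_s _ _ hz); rewrite subrr cmod0 leNgt d20.
  have := Bpoly_deriv z rn; rewrite {1}Bs horner_prod_deriv // -Bs.
  rewrite /quot /F; set S := \sum_(_ <- _) _; set B := _.[z] in Bz0 *; set T := _ * z ^+ r => E.
  have -> : T = n%:R * B - (1 + z) * (B * S) by rewrite E; ring.
  by field; rewrite nC0 Bz0.
have invle z w : cmod (z - zeta) <= delta / 2 -> w \in s -> cmod (z - w)^-1 <= 2 / delta.
  move=> hz ws; rewrite cmodV -[2 / delta]invf_div lef_pV2 ?posrE ?(near_s z) //.
  exact: lt_le_trans (near_s z w hz ws).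
have size_le : (size s)%:R / n%:R <= 1 :> R.
  by rewrite ler_pdivrMr ?ltr0n // mul1r ler_nat ss.
have sum_le (f : R[i] -> R[i]) (c : R) : 0 <= c -> (forall w, w \in s -> cmod (f w) <= c) ->
    cmod ((\sum_(w <- s) f w) / n%:R) <= c.
  move=> c0 fc; rewrite cmodM cmodV cmod_nat.
  apply: (@le_trans _ _ (((size s)%:R * c) / n%:R)).
    rewrite ler_pM2r ?invr_gt0 ?ltr0n //; apply: le_trans (cmod_sum _ _ _) _.
    have -> : (size s)%:R * c = \sum_(w <- s) c by rewrite big_const_seq count_predT iter_addr_0 mulr_natl.
    by rewrite !big_seq; apply: ler_sum => w ws; exact: fc.
  by rewrite mulrAC ler_piMl.
have i0 : 0 <= 2 / delta by rewrite divr_ge0 // ltW.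
have Fle : cmod (F z1) <= 2 / delta by apply: sum_le => // w; exact: invle.
have dF : F z1 - F z2 = (z2 - z1) * ((\sum_(w <- s) (z1 - w)^-1 * (z2 - w)^-1) / n%:R).
  rewrite /F -mulrBl -sumrB mulrA mulr_sumr; congr (_ / _).
  rewrite !big_seq; apply: eq_bigr => w ws.
  have nz z : cmod (z - zeta) <= delta / 2 -> z - w != 0.
    by move=> hz; rewrite -cmod_gt0 (lt_le_trans d20) // near_s.
  by field; rewrite !nz.
have dFle : cmod (F z1 - F z2) <= cmod (z1 - z2) * (2 / delta) ^+ 2.
  rewrite dF cmodM cmodB ler_wpM2l ?cmod_ge0 //; apply: sum_le; first exact: exprn_ge0.
  by move=> w ws; rewrite cmodM expr2 ler_pM ?cmod_ge0 ?invle.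
rewrite !quotE //.
have -> : 1 - (1 + z1) * F z1 - (1 - (1 + z2) * F z2) =
  - ((1 + z2) * (F z1 - F z2) + (z1 - z2) * F z1) by ring.
rewrite cmodN [leRHS]mulrDr; apply: le_trans (cmodD _ _) _; rewrite (cmodM (1 + z2)) (cmodM (z1 - z2)); apply: lerD.
  by rewrite mulrCA ler_wpM2l ?cmod_ge0.
by rewrite ler_wpM2l ?cmod_ge0.
Qed.

(** * Main term, power of 1 + z and tail at a fixed point *)

Section PointAsymptotics.
Context (R : realType) (r n : nat -> nat) (alpha : R)
  (rn_bound : forall j, (1 <= r j)%N /\ (r j < n j - 1)%N)
  (n_infty : n j @[j --> \oo] --> \oo)
  (ratio_cvg : (r j)%:R / (n j)%:R @[j --> \oo] --> alpha)
  (alpha01 : 0 < alpha < 1).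

Let p j : R := (r j)%:R / (n j)%:R.
Let a : R := alpha / (1 - alpha).
Let main_term j (z : R[i]) : R := 'C(n j, r j)%:R * cmod z ^+ r j.

Lemma ln_main_term z j : 0 < cmod z -> 0 < cmod (1 + z) ->
  ln (main_term j z / cmod (1 + z) ^+ n j) = (n j)%:R *
   (p j * ln (cmod z) - ln (cmod (1 + z)) + ln 'C(n j, r j)%:R / (n j)%:R).
Proof.
move=> z0 u0; have n0 := n_gt0 R rn_bound j; have [r1 rn] := rn_bound j.
have C0 : 0 < 'C(n j, r j)%:R :> R.
  by rewrite ltr0n bin_gt0; clear -rn; lia.
rewrite /main_term !lnM ?lnV ?posrE ?invr_gt0 ?mulr_gt0 ?exprn_gt0 //.
rewrite !lnXn // -[ln (cmod z) *+ _]mulr_natl -[ln _ *+ _]mulr_natl /p.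
by field; rewrite gt_eqF.
Qed.

Lemma ln_main_term_cvg z :
  p j * ln (cmod z) - ln (cmod (1 + z)) + ln 'C(n j, r j)%:R / (n j)%:R
    @[j --> \oo] --> level alpha z.
Proof.
apply: cvgD; last exact: ln_bin_cvg rn_bound n_infty ratio_cvg alpha01.
apply: cvgB; last exact: cvg_cst.
by apply: cvgM => //; exact: cvg_cst.
Qed.

(** The logarithm of the quotient is n times a sequence tending to the level, hence eventually at
    most n times half the level, which falls below ln eps. *)
Lemma main_term_small z : 0 < cmod z -> 0 < cmod (1 + z) -> level alpha z < 0 ->
  forall eps : R, 0 < eps ->
  \forall j \near \oo, main_term j z <= eps * cmod (1 + z) ^+ n j.
Proof.
move=> z0 u0 lz eps e0; have Hl := @ln_main_term_cvg z.
have Hi := @n_inv_cvg R _ _ rn_bound n_infty.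
pose M := 1 + `|ln eps|; have M0 : 0 < M by rewrite ltr_pwDl.
near=> j; have n0 := n_gt0 R rn_bound j.
have [r1 rn] := rn_bound j.
have C0 : 0 < 'C(n j, r j)%:R :> R by rewrite ltr0n bin_gt0; clear -rn; lia.
have m0 : 0 < main_term j z by rewrite mulr_gt0 ?exprn_gt0.
rewrite -ler_pdivrMr ?exprn_gt0 // -ler_ln ?posrE ?divr_gt0 ?exprn_gt0 // ln_main_term //.
have : p j * ln (cmod z) - ln (cmod (1 + z)) + ln 'C(n j, r j)%:R / (n j)%:R <= level alpha z / 2.
  near: j; apply: (cvgr_le _ Hl); lra.
set q := _ + _ => ql.
have iM : (n j)%:R^-1 <= - level alpha z / 2 / M.
  rewrite (le_trans (ler_norm _)) //; near: j; apply: (cvgr0_norm_le _ Hi).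
  by rewrite !divr_gt0 // oppr_gt0.
have nM : M <= (n j)%:R * (- level alpha z / 2).
  by move: iM; rewrite ler_pdivlMr // mulrC ler_pdivrMr // [leRHS]mulrC.
have : (n j)%:R * q <= (n j)%:R * (level alpha z / 2) by rewrite ler_pM2l.
have := ler_norm (- ln eps); rewrite normrN; move: nM; rewrite /M mulNr mulrN.
by lra.
Unshelve. all: by end_near.
Qed.

Lemma main_term_large z : 0 < cmod z -> 0 < cmod (1 + z) -> 0 < level alpha z ->
  \forall j \near \oo, cmod (1 + z) ^+ n j <= main_term j z.
Proof.
move=> z0 u0 lz; have Hl := @ln_main_term_cvg z.
near=> j; have n0 := n_gt0 R rn_bound j.
have [r1 rn] := rn_bound j.
have C0 : 0 < 'C(n j, r j)%:R :> R by rewrite ltr0n bin_gt0; clear -rn; lia.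
have m0 : 0 < main_term j z by rewrite mulr_gt0 ?exprn_gt0.
rewrite -[leLHS]mul1r -ler_pdivlMr ?exprn_gt0 // -ler_ln ?posrE ?divr_gt0 ?exprn_gt0 //.
rewrite ln1 ln_main_term // mulr_ge0 ?ltW //.
by near: j; exact: (cvgr_gt _ Hl).
Unshelve. all: by end_near.
Qed.

(** The ratio (n - r) / (r + 1) |z| is at most (1 - p) / p |z|, which tends to |z| / a < q. *)
Lemma tail_le_main_term z (q : R) : cmod z / a < q -> q < 1 ->
  \forall j \near \oo, cmod (bin_tail (r j) (n j) z) <= main_term j z / (1 - q).
Proof.
move=> zq q1; have /andP[al0 al1] := alpha01.
have Hq : (1 - p j) / p j * cmod z @[j --> \oo] --> cmod z / a.
  rewrite /a invf_div mulrC; apply: cvgM; last exact: cvg_cst.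
  apply: cvgM; last by apply: cvgV => //; rewrite gt_eqF.
  by apply: cvgB => //; exact: cvg_cst.
near=> j; apply: cmod_bin_tail_lt => //.
have n0 := n_gt0 R rn_bound j; have [r1 rn] := rn_bound j.
have rn' : (r j <= n j)%N by clear -rn; lia.
apply: (@le_trans _ _ ((1 - p j) / p j * cmod z)); last first.
  by near: j; exact: (cvgr_le _ Hq).
rewrite ler_wpM2r ?cmod_ge0 //.
have -> : (1 - p j) / p j = (n j - r j)%:R / (r j)%:R.
  have -> : 1 - p j = (n j - r j)%:R / (n j)%:R.
    by rewrite natrB // mulrBl divff ?lt0r_neq0.
  by rewrite /p invf_div mulrA divfK // lt0r_neq0.
by rewrite ler_wpM2l // lef_pV2 ?posrE ?ltr0n // ler_nat.
Unshelve. all: by end_near.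
Qed.

End PointAsymptotics.

(** * Geometry of the curve *)

Lemma is_derive_pos_sides (R : realType) (f : R -> R) (D : R) :
  is_derive (0 : R) (1 : R) f D -> 0 < D -> exists2 e : R, 0 < e &
    forall h, h != 0 -> `|h| < e -> 0 < h^-1 * (f h - f 0).
Proof.
case=> df dE D0; have := df; rewrite /derivable => /cvg_ex[l lE].
have lD : l = D by rewrite -dE; apply/esym/cvg_lim => //.
move: lE; rewrite lD => /cvgr_gt /(_ _ D0) /nbhs_ballP[e /= e0 He].
exists e => // h h0 he; have := He h; rewrite /ball /= sub0r normrN => /(_ he h0).
by rewrite addr0 /GRing.scale /= mulr1.
Qed.

Lemma ln_cmod (R : realType) (z : R[i]) : 0 < cmod z ->
  ln (cmod z) = ln (complex.Re z ^+ 2 + complex.Im z ^+ 2) / 2.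
Proof. by move=> z0; rewrite -sqr_cmod lnXn // -[ln _ *+ _]mulr_natl mulrC mulKf. Qed.

(** Used for ln |zeta + t v|^2 and ln |1 + zeta + t v|^2 along a line through zeta. *)
Lemma is_derive_ln_sqr_dist (R : realType) (a b c d : R) : 0 < a ^+ 2 + c ^+ 2 ->
  is_derive (0 : R) (1 : R) (fun t : R => ln ((a + t * b) ^+ 2 + (c + t * d) ^+ 2))
    (2 * (a * b + c * d) / (a ^+ 2 + c ^+ 2)).
Proof.
move=> ac0; pose g t : R := (a + t * b) ^+ 2 + (c + t * d) ^+ 2.
have lin (u v : R) : is_derive (0 : R) (1 : R) (fun t : R => u + t * v) v.
  have H := is_deriveD (is_derive_cst u (0 : R) (1 : R))
    (is_deriveM (is_derive_id (0 : R) (1 : R)) (is_derive_cst v (0 : R) (1 : R))).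
  by apply: (is_derive_eq H); rewrite /cst /= /GRing.scale /= mul0r mulr1 !add0r.
have dg : is_derive (0 : R) (1 : R) g (2 * (a * b + c * d)).
  have H := is_deriveD (is_deriveX 2 (lin a b)) (is_deriveX 2 (lin c d)).
  by apply: (is_derive_eq H); rewrite /= /GRing.scale /= !mul0r !addr0; ring.
have g0 : g 0 = a ^+ 2 + c ^+ 2 by rewrite /g !mul0r !addr0.
have dl : is_derive (g 0) 1 (@ln R) (a ^+ 2 + c ^+ 2)^-1.
  by rewrite g0; exact: is_derive1_ln.
by apply: (is_derive_eq (is_derive1_comp dl dg)); rewrite mulrC.
Qed.

(* The level increases to first order along the conjugate of the derivative
   [alpha / z - 1 / (1 + z)] of [alpha * log z - log (1 + z)]; this derivative
   vanishes only at [alpha / (1 - alpha)]. *)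
Lemma level_sides (R : realType) (alpha : R) (zeta : R[i]) (tau : R) :
  0 < alpha < 1 -> 0 < cmod zeta -> 0 < cmod (1 + zeta) ->
  zeta != (alpha / (1 - alpha))%:C%C -> 0 < tau ->
  exists z1 z2, [/\ cmod (z1 - zeta) < tau, cmod (z2 - zeta) < tau,
    level alpha z1 < level alpha zeta & level alpha zeta < level alpha z2].
Proof.
case/andP=> al0 al1 z0 u0 zeta_a tau0; case: zeta z0 u0 zeta_a => x y z0 u0 zeta_a.
pose X := x ^+ 2 + y ^+ 2; pose U := (1 + x) ^+ 2 + y ^+ 2.
have XE : X = cmod (Complex x y) ^+ 2 by rewrite sqr_cmod.
have UE : U = cmod (1 + Complex x y) ^+ 2 by rewrite sqr_cmod cReD cImD /= add0r.
have X0 : 0 < X by rewrite XE exprn_gt0.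
have U0 : 0 < U by rewrite UE exprn_gt0.
pose vx := alpha * x / X - (1 + x) / U; pose vy := alpha * y / X - y / U.
pose f t := alpha * (ln ((x + t * vx) ^+ 2 + (y + t * vy) ^+ 2) / 2)
   - ln ((1 + x + t * vx) ^+ 2 + (y + t * vy) ^+ 2) / 2.
have D0 : 0 < vx ^+ 2 + vy ^+ 2.
  rewrite lt_def addr_ge0 ?sqr_ge0 // andbT paddr_eq0 ?sqr_ge0 // !sqrf_eq0.
  apply: contra zeta_a => /andP[/eqP vx0 /eqP vy0].
  have eX : alpha * x * U = (1 + x) * X.
    by move/eqP: vx0; rewrite subr_eq0 eqr_div ?lt0r_neq0 // => /eqP.
  have eY : alpha * y * U = y * X.
    by move/eqP: vy0; rewrite subr_eq0 eqr_div ?lt0r_neq0 // => /eqP.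
  (* If y were nonzero, [eY] would give alpha U = X, and [eX] would reduce to x = 1 + x. *)
  have y0 : y = 0.
    apply/eqP; apply/negPn/negP => y0.
    have aU : alpha * U = X by apply: (mulfI y0); rewrite -eY; ring.
    have : x * X = (1 + x) * X by rewrite -eX -aU; ring.
    by move/(mulIf (lt0r_neq0 X0)); lra.
  rewrite y0 eq_complex /= eqxx andbT; apply/eqP.
  have x0 : x != 0 by apply: contraTneq X0 => x0; rewrite /X x0 y0 !expr0n addr0 ltxx.
  have x1 : 1 + x != 0 by apply: contraTneq U0 => x1; rewrite /U x1 y0 !expr0n addr0 ltxx.
  have : alpha * (1 + x) = x.
    apply: (mulfI (mulf_neq0 x0 x1)); move: eX; rewrite /X /U y0 expr0n /= !addr0.
    by move=> eX; transitivity (alpha * x * (1 + x) ^+ 2); [ring | rewrite eX; ring].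
  move=> E; apply: (canRL (mulfK _)); last by lra.
  by rewrite gt_eqF // subr_gt0.
have df : is_derive (0 : R) (1 : R) f (vx ^+ 2 + vy ^+ 2).
  have dX := @is_derive_ln_sqr_dist R x vx y vy X0.
  have dU := @is_derive_ln_sqr_dist R (1 + x) vx y vy U0.
  have H := is_deriveB (is_deriveZ alpha (is_deriveZ 2^-1 dX)) (is_deriveZ 2^-1 dU).
  have Ef : alpha *: (2^-1 *: (fun t : R => ln ((x + t * vx) ^+ 2 + (y + t * vy) ^+ 2)))
     - 2^-1 *: (fun t : R => ln ((1 + x + t * vx) ^+ 2 + (y + t * vy) ^+ 2)) = f.
    by apply/funext => t; rewrite /f ![_ / 2]mulrC.
  rewrite Ef in H; apply: (is_derive_eq H); rewrite -/X -/U /GRing.scale /= /vx /vy.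
  by field; rewrite !lt0r_neq0.
have [e e0 He] := is_derive_pos_sides df D0.
have levelE t : `|t| * cmod (Complex vx vy) < cmod (Complex x y) ->
  `|t| * cmod (Complex vx vy) < cmod (1 + Complex x y) ->
  level alpha (Complex (x + t * vx) (y + t * vy)) = f t - entropy alpha.
  have zE : Complex (x + t * vx) (y + t * vy) = Complex x y + t%:C%C * Complex vx vy.
    by apply/eqP; rewrite eq_complex /= !mul0r subr0 addr0 !eqxx.
  move=> t1 t2.
  have z0' : 0 < cmod (Complex (x + t * vx) (y + t * vy)).
    by rewrite zE (lt_le_trans _ (cmodD_ge _ _)) // cmodM cmod_real subr_gt0.
  have u0' : 0 < cmod (1 + Complex (x + t * vx) (y + t * vy)).
    by rewrite zE addrA (lt_le_trans _ (cmodD_ge _ _)) // cmodM cmod_real subr_gt0.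
  by rewrite /level /f !ln_cmod // cReD cImD /= add0r addrA.
set V := cmod _ in levelE.
have V2 : V ^+ 2 = vx ^+ 2 + vy ^+ 2 by rewrite sqr_cmod.
have V0 : 0 < V.
  by rewrite lt_def cmod_ge0 andbT; apply: contraTneq D0 => V0; rewrite -V2 V0 expr0n ltxx.
pose m := Num.min (cmod (Complex x y)) (cmod (1 + Complex x y)).
have m0 : 0 < m by rewrite lt_min z0 u0.
(* A step small enough for the sign of the difference quotient, for staying within tau of zeta, and
   for avoiding 0 and -1. *)
pose h := Num.min (e / 2) (Num.min m tau / (2 * V)).
have h0 : 0 < h.
  by rewrite lt_min !divr_gt0 ?mulr_gt0 // lt_min m0 tau0.
have he : h < e by rewrite gt_min ltr_pdivrMr // ltr_pMr // ltr1n.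
have mt0 : 0 < Num.min m tau by rewrite lt_min m0 tau0.
have hV : h * V < Num.min m tau.
  have : h <= Num.min m tau / (2 * V) by rewrite ge_min lexx orbT.
  by rewrite ler_pdivlMr ?mulr_gt0 //; move: (Num.min m tau) mt0 => M M0; lra.
have hVm : h * V < m by rewrite (lt_le_trans hV) // ge_min lexx.
have hVx : h * V < cmod (Complex x y) by rewrite (lt_le_trans hVm) // ge_min lexx.
have hVu : h * V < cmod (1 + Complex x y) by rewrite (lt_le_trans hVm) // ge_min lexx orbT.
have hVt : h * V < tau by rewrite (lt_le_trans hV) // ge_min lexx orbT.
have dist t : cmod (Complex (x + t * vx) (y + t * vy) - Complex x y) = `|t| * V.
  rewrite -cmod_real -cmodM; congr cmod; apply/eqP; rewrite eq_complex /=.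
  by rewrite !mul0r subr0 addr0 ![_ + _ * _]addrC !addrK !eqxx.
have level0 : level alpha (Complex x y) = f 0 - entropy alpha.
  by have := levelE 0; rewrite normr0 !mul0r !addr0; apply.
have nh : `|- h| = h by rewrite normrN gtr0_norm.
have ph : `|h| = h by rewrite gtr0_norm.
exists (Complex (x + - h * vx) (y + - h * vy)), (Complex (x + h * vx) (y + h * vy)).
rewrite !dist nh ph; split=> //.
  rewrite levelE ?nh // level0 ltrD2r; have := He (- h).
  rewrite nh oppr_eq0 gt_eqF // => /(_ isT he).
  by rewrite invrN mulNr oppr_gt0 pmulr_rlt0 ?invr_gt0 // subr_lt0.
rewrite levelE ?ph // level0 ltrD2r; have := He h.
rewrite ph gt_eqF // => /(_ isT he).
by rewrite pmulr_rgt0 ?invr_gt0 // subr_gt0.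
Qed.

(** For |z| = a the curve equation forces |1 + z| = 1 / (1 - alpha) = 1 + a, the equality case of
    the triangle inequality. *)
Lemma Ccurve_extremal (R : realType) (alpha : R) (z : R[i]) : 0 < alpha < 1 ->
  Ccurve alpha z -> cmod z = alpha / (1 - alpha) -> z = (alpha / (1 - alpha))%:C%C.
Proof.
move=> a01 Cz za; have [z0 u0] := Ccurve_neq a01 Cz.
have /(CcurveP a01 z0 u0)[lz _] := Cz; have /andP[al0 al1] := a01.
have b0 : 0 < 1 - alpha by rewrite subr_gt0.
set a := alpha / (1 - alpha) in za *; have a0 : 0 < a by rewrite divr_gt0.
have a1 : 1 + a = (1 - alpha)^-1 by rewrite /a; field; rewrite gt_eqF.
have u1 : cmod (1 + z) = 1 + a.
  apply: (@ln_inj R); rewrite ?posrE ?addr_gt0 //.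
  move: lz; rewrite /level /entropy za a1 /a lnM ?posrE ?invr_gt0 // !lnV ?posrE //.
  by move=> lz; apply/eqP; rewrite -subr_eq0; apply/eqP; lra.
have /(congr1 (fun t => t ^+ 2)) := u1; have /(congr1 (fun t => t ^+ 2)) := za.
rewrite !sqr_cmod cReD cImD /= add0r; case: (z) => x y /= e1 e2.
have xa : x = a.
  have : 2 * x = (1 + x) ^+ 2 + y ^+ 2 - (x ^+ 2 + y ^+ 2) - 1 by ring.
  rewrite e1 e2 (_ : _ - 1 = 2 * a); last by ring.
  by move/mulfI; apply; rewrite pnatr_eq0.
apply/eqP; rewrite eq_complex /= xa eqxx /= -sqrf_eq0.
by apply/eqP; move: e1; rewrite xa; lra.
Qed.

(** Apply ln y <= y - 1 to x / ((1 + x) alpha) and 1 / ((1 + x) (1 - alpha)), whose mean with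
    weights alpha and 1 - alpha is 1. *)
Lemma weighted_log_le (R : realType) (alpha x : R) : 0 < alpha < 1 -> 0 < x ->
  alpha * ln x - entropy alpha <= ln (1 + x).
Proof.
case/andP=> al0 al1 x0; have b0 : 0 < 1 - alpha by rewrite subr_gt0.
have x1 : 0 < 1 + x by rewrite addr_gt0.
have lnle (y : R) : 0 < y -> ln y <= y - 1.
  by move=> y0; rewrite -{1}(subrKC 1 y) le_ln1Dx //; lra.
have H1 : ln (x / (1 + x) / alpha) <= x / (1 + x) / alpha - 1.
  by apply: lnle; rewrite !divr_gt0.
have H2 : ln ((1 + x)^-1 / (1 - alpha)) <= (1 + x)^-1 / (1 - alpha) - 1.
  by apply: lnle; rewrite !divr_gt0 ?invr_gt0.
have {}H1 : alpha * ln (x / (1 + x) / alpha) <= x / (1 + x) - alpha.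
  have -> : x / (1 + x) - alpha = alpha * (x / (1 + x) / alpha - 1).
    by field; rewrite !lt0r_neq0.
  by rewrite ler_pM2l.
have {}H2 : (1 - alpha) * ln ((1 + x)^-1 / (1 - alpha)) <= (1 + x)^-1 - (1 - alpha).
  have -> : (1 + x)^-1 - (1 - alpha) = (1 - alpha) * ((1 + x)^-1 / (1 - alpha) - 1).
    by field; rewrite !lt0r_neq0.
  by rewrite ler_pM2l.
have S : x / (1 + x) + (1 + x)^-1 = 1 by field; rewrite lt0r_neq0.
move: H1 H2; rewrite !lnM ?posrE ?invr_gt0 ?divr_gt0 // !lnV ?posrE // /entropy.
by move: S; set A := x / _; set B := _^-1; nra.
Qed.

(** On the curve a modulus x prescribes |1 + z| = rho x. For x slightly below a, a triangle with
    sides 1, x and rho x exists, and its vertex z tends to a as x does. *)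
Lemma Ccurve_near_extremal (R : realType) (alpha eps : R) : 0 < alpha < 1 -> 0 < eps ->
  exists2 z : R[i], Ccurve alpha z &
    cmod z < alpha / (1 - alpha) /\ cmod (z - (alpha / (1 - alpha))%:C%C) < eps.
Proof.
move=> a01 e0; have /andP[al0 al1] := a01; have b0 : 0 < 1 - alpha by rewrite subr_gt0.
set a := alpha / (1 - alpha); have a0 : 0 < a by rewrite divr_gt0.
have a1 : 1 + a = (1 - alpha)^-1 by rewrite /a; field; rewrite gt_eqF.
pose rho x : R := expR (alpha * ln x - entropy alpha).
(* By the law of cosines, the cosine of the argument of a point with |z| = x and |1 + z| = rho x. *)
pose c x : R := (rho x ^+ 2 - 1 - x ^+ 2) / (2 * x).
have rhoa : rho a = 1 + a.
  rewrite /rho /entropy -[1 + a]lnK ?posrE ?addr_gt0 //; congr expR.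
  by rewrite a1 /a lnM ?posrE ?invr_gt0 // !lnV ?posrE //; ring.
have rho_cont : rho x @[x --> a] --> 1 + a.
  have H : alpha * ln x - entropy alpha @[x --> a] --> alpha * ln a - entropy alpha.
    apply: cvgB; last exact: cvg_cst.
    by apply: cvgM; [exact: cvg_cst | exact: continuous_ln].
  by rewrite -rhoa; apply: (cvg_comp _ _ H); exact: continuous_expR.
have ca : ((1 + a) ^+ 2 - 1 - a ^+ 2) / (2 * a) = 1 by field; rewrite gt_eqF.
have c_cont : c x @[x --> a] --> (1 : R).
  rewrite -ca; apply: cvgM.
    apply: cvgB; last by rewrite expr2; apply: cvgM; exact: cvg_id.
    apply: cvgB; last exact: cvg_cst.
    by rewrite expr2; exact: cvgM.
  apply: cvgV; first by rewrite mulf_neq0 // gt_eqF.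
  by apply: cvgM; [exact: cvg_cst | exact: cvg_id].
(* The expression is the squared distance from that point to a. *)
have d_cont : x ^+ 2 - 2 * a * x * c x + a ^+ 2 @[x --> a] --> 0.
  have -> : 0 = a ^+ 2 - 2 * a * a * 1 + a ^+ 2 by ring.
  apply: cvgD; last exact: cvg_cst.
  apply: cvgB; first by rewrite expr2; apply: cvgM; exact: cvg_id.
  by apply: cvgM => //; apply: cvgM; [exact: cvg_cst | exact: cvg_id].
have [x [x0 xa cx dx]] : exists x : R, [/\ 0 < x, x < a, - 1 <= c x &
    x ^+ 2 - 2 * a * x * c x + a ^+ 2 < eps ^+ 2].
  have : \forall x \near a, [/\ 0 < x, - 1 <= c x & x ^+ 2 - 2 * a * x * c x + a ^+ 2 < eps ^+ 2].
    near=> x; split; near: x.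
    - exact: lt_nbhsr.
    - by apply: (cvgr_ge _ c_cont); lra.
    - by apply: (cvgr_lt _ d_cont); rewrite exprn_gt0.
  move=> /nbhs_ballP[e /= ee He]; pose x := a - e / 2.
  have : ball a e x by rewrite /ball /= /x opprB addrC subrK gtr0_norm ?divr_gt0 // ltr_pdivrMr // ltr_pMr // ltr1n.
  by case/He => ? ? ?; exists x; split=> //; rewrite ltrBlDr ltrDl divr_gt0.
have rho0 : 0 < rho x by exact: expR_gt0.
have rho_le : rho x <= 1 + x.
  by rewrite -ler_ln ?posrE ?addr_gt0 // expRK weighted_log_le.
have cE : 2 * x * c x = rho x ^+ 2 - 1 - x ^+ 2.
  by rewrite /c mulrC divfK // mulf_neq0 // gt_eqF.
have c1 : c x <= 1.
  rewrite -(ler_pM2l (_ : 0 < 2 * x)) ?mulr_gt0 // cE mulr1.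
  have : rho x ^+ 2 <= (1 + x) ^+ 2 by rewrite lerXn2r ?nnegrE ?addr_ge0 // ltW.
  by rewrite sqrrD; lra.
have s0 : 0 <= 1 - c x ^+ 2 by nra.
move: (c x) cx dx cE c1 s0 => C cx dx cE c1 s0.
pose z : R[i] := Complex (x * C) (x * Num.sqrt (1 - C ^+ 2)).
have zx : cmod z = x.
  apply/eqP; rewrite -(@eqrXn2 _ 2) ?cmod_ge0 ?(ltW x0) // sqr_cmod /= !exprMn sqr_sqrtr //.
  by apply/eqP; ring.
have z1 : cmod (1 + z) = rho x.
  apply/eqP; rewrite -(@eqrXn2 _ 2) ?cmod_ge0 ?(ltW rho0) // sqr_cmod cReD cImD /= add0r !exprMn sqr_sqrtr //.
  apply/eqP; have -> : rho x ^+ 2 = 1 + 2 * x * C + x ^+ 2 by rewrite cE; ring.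
  by ring.
exists z; last split; rewrite ?zx //.
  apply/CcurveP; rewrite ?zx ?z1 //; split; last exact: ltW.
  by rewrite /level zx z1 expRK; ring.
rewrite -(@ltr_pXn2r _ 2) ?nnegrE ?cmod_ge0 ?(ltW e0) // sqr_cmod /= subr0 !exprMn sqr_sqrtr //.
by apply: le_lt_trans dx; rewrite le_eqVlt; apply/orP; left; apply/eqP; ring.
Unshelve. all: by end_near.
Qed.

(** * Accumulation of zeros at every point of the curve *)

Section ZerosNearCurve.
Context (R : realType) (r n : nat -> nat) (alpha : R)
  (rn_bound : forall j, (1 <= r j)%N /\ (r j < n j - 1)%N)
  (n_infty : n j @[j --> \oo] --> \oo)
  (ratio_cvg : (r j)%:R / (n j)%:R @[j --> \oo] --> alpha)
  (alpha01 : 0 < alpha < 1).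

Lemma cmod_quot j (z : R[i]) : cmod (quot (r j) (n j) z) =
  (1 - (r j)%:R / (n j)%:R) *
    ('C(n j, r j)%:R * cmod z ^+ r j / cmod (Bpoly R (r j) (n j)).[z]).
Proof.
have n0 := n_gt0 R rn_bound j; have [_ rn] := rn_bound j.
have rn' : (r j <= n j)%N by clear -rn; lia.
rewrite /quot !cmodM cmodV cmodM cmodX !cmod_nat invfM natrB //.
have -> : 1 - (r j)%:R / (n j)%:R = ((n j)%:R - (r j)%:R) / (n j)%:R :> R.
  by rewrite mulrBl divff ?lt0r_neq0.
by ring.
Qed.

(* If there were no zero near [zeta], [quot] would be uniformly Lipschitz there;
   but it tends to 0 where the level is negative and stays away from 0 where the
   level is positive. *)
Lemma zero_near_interior (zeta : R[i]) (eps : R) : Ccurve alpha zeta ->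
  cmod zeta < alpha / (1 - alpha) -> 0 < eps ->
  \forall j \near \oo, exists2 z, root (Bpoly R (r j) (n j)) z & cmod (z - zeta) < eps.
Proof.
move=> Czeta zeta_a e0; have /andP[al0 al1] := alpha01.
have [z0 u0] := Ccurve_neq alpha01 Czeta; have /(CcurveP alpha01 z0 u0)[lz _] := Czeta.
set a := alpha / (1 - alpha) in zeta_a; have a0 : 0 < a by rewrite divr_gt0 // subr_gt0.
pose delta := Num.min eps 1.
have d0 : 0 < delta by rewrite lt_min e0 ltr01.
pose q := (cmod zeta / a + 1) / 2.
have za1 : cmod zeta / a < 1 by rewrite ltr_pdivrMr // mul1r.
have q1 : q < 1 by rewrite /q; lra.
have qz : cmod zeta / a < q by rewrite /q; lra.
(* M bounds |T| / m near zeta, c will be a lower bound for |quot| at z2, and L is the Lipschitz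
   constant, where delta <= 1 gives |1 + z2| <= 2 + |zeta|. *)
pose M := (1 - q)^-1; have M0 : 0 < M by rewrite invr_gt0 subr_gt0.
pose c := (1 - alpha) / 2 / (1 + M).
have c0 : 0 < c by rewrite !divr_gt0 ?subr_gt0 // addr_gt0.
pose L := (2 + cmod zeta) * (2 / delta) ^+ 2 + 2 / delta.
have i0 : 0 < 2 / delta by rewrite divr_gt0.
have L0 : 0 < L by rewrite addr_gt0 // mulr_gt0 ?exprn_gt0 // addr_gt0.
(* Within tau of zeta the Lipschitz bound applies, |z| / a stays below q, and 0 and -1 are avoided;
   the last entry ensures 2 tau L <= c / 4. *)
pose tau := Num.min (Num.min (delta / 2) (q * a - cmod zeta))
  (Num.min (Num.min (cmod zeta) (cmod (1 + zeta))) (c / (8 * L))).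
have tau0 : 0 < tau.
  have qa : 0 < q * a - cmod zeta by rewrite subr_gt0 -ltr_pdivrMr.
  have cL : 0 < c / (8 * L) by rewrite divr_gt0 // mulr_gt0.
  by rewrite !lt_min z0 u0 qa cL divr_gt0.
have tau_d : tau <= delta / 2 by rewrite !ge_min lexx.
have tau_q : tau <= q * a - cmod zeta by rewrite !ge_min lexx orbT.
have tau_z : tau <= cmod zeta by rewrite !ge_min lexx !orbT.
have tau_u : tau <= cmod (1 + zeta) by rewrite !ge_min lexx !orbT.
have tau_L : 8 * (tau * L) <= c.
  have : tau <= c / (8 * L) by rewrite !ge_min lexx !orbT.
  by rewrite ler_pdivlMr ?mulr_gt0 // mulrCA.
have zeta_neq : zeta != a%:C%C.
  by apply: contraTneq zeta_a => ->; rewrite cmod_real gtr0_norm // ltxx.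
have [z1 [z2 [h1 h2]]] := level_sides alpha01 z0 u0 zeta_neq tau0.
rewrite lz => l1 l2.
have near_pos z : cmod (z - zeta) < tau ->
    [/\ 0 < cmod z, 0 < cmod (1 + z), cmod z / a < q & cmod (z - zeta) <= delta / 2].
  move=> hz; split; last by rewrite ltW // (lt_le_trans hz).
  - have := cmodD_ge zeta (z - zeta); rewrite subrKC; lra.
  - have := cmodD_ge (1 + zeta) (z - zeta); rewrite -addrA subrKC; lra.
  - rewrite ltr_pdivrMr //; have := cmodD zeta (z - zeta); rewrite subrKC; lra.
have [z1p u1p z1q z1d] := near_pos z1 h1; have [z2p u2p z2q z2d] := near_pos z2 h2.
(* Then |1 + z1|^n >= (M + 4 / c) m1; subtracting the tail, at most M m1, leaves |B(z1)| >= (4 / c)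
   m1, whence |quot| <= c / 4 at z1. *)
pose eps1 := (M + 4 / c)^-1.
have c40 : 0 < 4 / c by rewrite divr_gt0.
have eps10 : 0 < eps1 by rewrite invr_gt0 addr_gt0.
have N1 := main_term_small rn_bound n_infty ratio_cvg alpha01 z1p u1p l1 eps10.
have N2 := main_term_large rn_bound n_infty ratio_cvg alpha01 z2p u2p l2.
have T1 := tail_le_main_term rn_bound ratio_cvg alpha01 z1q q1.
have T2 := tail_le_main_term rn_bound ratio_cvg alpha01 z2q q1.
near=> j.
have n0 := n_gt0 R rn_bound j; have [r1 rn] := rn_bound j.
have rn' : (r j <= n j)%N by clear -rn; lia.
have C0 : 0 < 'C(n j, r j)%:R :> R by rewrite ltr0n bin_gt0.
apply: contrapT => nozero.
have far w : root (Bpoly R (r j) (n j)) w -> delta <= cmod (w - zeta).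
  move=> Bw; rewrite leNgt; apply/negP => wz; apply: nozero; exists w => //.
  by rewrite (lt_le_trans wz) // ge_min lexx.
have B2 : 0 < cmod (Bpoly R (r j) (n j)).[z2].
  rewrite cmod_gt0; apply/negP => /far; rewrite leNgt (le_lt_trans z2d) //.
  by rewrite ltr_pdivrMr // ltr_pMr // ltr1n.
have p_lt : (1 - alpha) / 2 <= 1 - (r j)%:R / (n j)%:R.
  have : (r j)%:R / (n j)%:R <= alpha + (1 - alpha) / 2.
    by near: j; apply: (cvgr_le _ ratio_cvg); rewrite ltrDl divr_gt0 // subr_gt0.
  by lra.
have p_ge : 1 - (r j)%:R / (n j)%:R <= 1 :> R by rewrite lerBlDr lerDl divr_ge0.
have main1 : 'C(n j, r j)%:R * cmod z1 ^+ r j <= eps1 * cmod (1 + z1) ^+ n j.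
  by near: j.
have main2 : cmod (1 + z2) ^+ n j <= 'C(n j, r j)%:R * cmod z2 ^+ r j by near: j.
have tail1 : cmod (bin_tail (r j) (n j) z1) <= 'C(n j, r j)%:R * cmod z1 ^+ r j * M.
  by near: j.
have tail2 : cmod (bin_tail (r j) (n j) z2) <= 'C(n j, r j)%:R * cmod z2 ^+ r j * M.
  by near: j.
move: (Bpoly_tail z1 rn') (Bpoly_tail z2 rn') (cmod_quot j z1) (cmod_quot j z2) => b1 b2 Q1 Q2.
have lip := quot_lipschitz (_ : (0 < n j)%N) rn' d0 far z1d z2d.
set m1 := _ * cmod z1 ^+ _ in main1 tail1 Q1; set m2 := _ * cmod z2 ^+ _ in main2 tail2 Q2.
have m10 : 0 < m1 by rewrite mulr_gt0 ?exprn_gt0.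
have m20 : 0 < m2 by rewrite mulr_gt0 ?exprn_gt0.
have B1 : 4 / c * m1 <= cmod (Bpoly R (r j) (n j)).[z1].
  have : cmod ((1 + z1) ^+ n j) <= cmod (Bpoly R (r j) (n j)).[z1] + m1 * M.
    by rewrite b1; apply: le_trans (cmodD _ _) _; rewrite lerD2l.
  move: main1; rewrite -ler_pdivrMl // invrK cmodX; lra.
have le1 : cmod (quot (r j) (n j) z1) <= c / 4.
  rewrite Q1 -[c / 4]mul1r; apply: ler_pM => //.
  - by apply: le_trans p_lt; rewrite divr_ge0 // subr_ge0 ltW.
  - by rewrite divr_ge0 ?cmod_ge0 // ltW.
  rewrite ler_pdivrMr; last by apply: lt_le_trans B1; rewrite mulr_gt0.
  have -> : m1 = c / 4 * (4 / c * m1) by field; rewrite lt0r_neq0.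
  by apply: ler_wpM2l B1; rewrite divr_ge0 // ltW.
have ge2 : c <= cmod (quot (r j) (n j) z2).
  rewrite Q2 /c; apply: ler_pM => //.
  - by rewrite divr_ge0 // subr_ge0 ltW.
  - by rewrite invr_ge0 addr_ge0 // ltW.
  rewrite ler_pdivlMr // mulrC ler_pdivrMr ?addr_gt0 //.
  have -> : (Bpoly R (r j) (n j)).[z2] = (1 + z2) ^+ n j - bin_tail (r j) (n j) z2.
    by rewrite b2 addrK.
  by apply: le_trans (cmodBD _ _) _; rewrite cmodX mulrDr mulr1 lerD.
have z12 : cmod (z1 - z2) <= 2 * tau.
  have := cmodBD (z1 - zeta) (z2 - zeta).
  rewrite (_ : z1 - zeta - (z2 - zeta) = z1 - z2); last by ring.
  by lra.
have z2L : cmod (1 + z2) * (2 / delta) ^+ 2 + 2 / delta <= L.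
  rewrite lerD2r ler_wpM2r ?sqr_ge0 //.
  have := cmodD (1 + zeta) (z2 - zeta); rewrite -addrA subrKC.
  have := cmodD 1 zeta; rewrite cmod1; have : delta <= 1 by rewrite ge_min lexx orbT.
  by lra.
have lipc : cmod (quot (r j) (n j) z1 - quot (r j) (n j) z2) <= c / 4.
  apply: le_trans (lip _) _; first by clear -rn; lia.
  apply: (@le_trans _ _ (2 * tau * L)); last by clear -tau_L; move: (tau) (L) (c) tau_L => t l k; lra.
  apply: ler_pM => //; first exact: cmod_ge0.
  by rewrite addr_ge0 ?(ltW i0) // mulr_ge0 ?cmod_ge0 // sqr_ge0.
(* The two values of [quot] differ by at least c - c / 4 in modulus, while the Lipschitz bound
   allows only c / 4. *)
have := cmodB_ge (quot (r j) (n j) z2) (quot (r j) (n j) z1).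
by rewrite cmodB; lra.
Unshelve. all: by end_near.
Qed.

Lemma zero_near_curve (zeta : R[i]) (eps : R) : Ccurve alpha zeta -> 0 < eps ->
  \forall j \near \oo, exists2 z, root (Bpoly R (r j) (n j)) z & cmod (z - zeta) < eps.
Proof.
move=> Czeta e0; have [za|za] := eqVneq (cmod zeta) (alpha / (1 - alpha)); last first.
  by apply: zero_near_interior => //; rewrite lt_neqAle za; case: Czeta.
have e20 : 0 < eps / 2 by rewrite divr_gt0.
have [w Cw [wa wz]] := Ccurve_near_extremal alpha01 e20.
rewrite -(Ccurve_extremal alpha01 Czeta za) in wz.
have := zero_near_interior Cw wa e20; apply: filterS => j [z Bz zw]; exists z => //.
have := cmodD (z - w) (w - zeta); rewrite addrA subrK; lra.
Qed.

Lemma curve_limit_point (zeta : R[i]) : Ccurve alpha zeta ->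
  limit_point_of_zeros (fun j => Bpoly R (r j) (n j)) zeta.
Proof.
move=> Czeta.
have ex i : exists N, forall j, (N <= j)%N ->
    exists z, root (Bpoly R (r j) (n j)) z /\ cmod (z - zeta) < i.+1%:R^-1.
  have [|N _ HN] := @zero_near_curve zeta i.+1%:R^-1 Czeta; first by rewrite invr_gt0.
  by exists N => j /HN[z Bz zz]; exists z.
have [N HN] := choice ex.
(* Partial sums of N k + 1 dominate each threshold and are strictly increasing. *)
pose phi i := (\sum_(k < i.+1) (N k).+1)%N.
have phi_ge i : (N i <= phi i)%N by rewrite /phi big_ord_recr /= addnS leqW // leq_addl.
have phiS i : (phi i < phi i.+1)%N.
  by rewrite /phi [in X in (_ < X)%N]big_ord_recr /= addnS ltnS leq_addr.
have [z Hz] := choice (fun i => HN i (phi i) (phi_ge i)).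
exists phi, z; split.
- exact: (homo_ltn ltn_trans phiS).
- by move=> i; case: (Hz i).
apply/cvgrPdist_lt => e e0.
(* The norm on [R[i]^o] is complex-valued, so the positive e is a complex number with zero imaginary
   part. *)
have eE : e = (complex.Re e)%:C%C.
  by move: e0; case: (e) => x y; rewrite ltcE /= => /andP[/eqP -> _].
have re0 : 0 < complex.Re e by move: e0; rewrite ltcE => /andP[].
near=> i; rewrite eE norm_cmod ltcR cmodB.
apply: lt_trans (proj2 (Hz i)) _.
near: i; exact: near_infty_natSinv_lt (PosNum re0).
Unshelve. all: by end_near.
Qed.

End ZerosNearCurve.

Theorem theorem2p2 (R : realType) (r n : nat -> nat) (alpha : R)
    (rn_bound : forall j, (1 <= r j)%N /\ (r j < n j - 1)%N)
    (n_infty : n j @[j --> \oo] --> \oo)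
    (ratio_cvg : (r j)%:R / (n j)%:R @[j --> \oo] --> alpha)
    (alpha01 : 0 < alpha < 1) :
  sup_dist (zeros (Bpoly R (r j) (n j))) (Ccurve alpha) @[j --> \oo] --> 0%E
  /\ (forall zeta : R[i]%C, Ccurve alpha zeta ->
        limit_point_of_zeros (fun j => Bpoly R (r j) (n j)) zeta).
Proof.
split; first exact: zeros_sup_dist_cvg.
by move=> zeta; exact: curve_limit_point.
Qed.
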